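(* Let $k\ge 0$ and let $\hat u\in C^1([0,T];V^k\cap L^2(\mathbb R))$ be a solution of the DDG method (defined in the context), where the diffusive flux $\hat h$ satisfies the admissibility condition with constants $\gamma\in(0,1)$ and $\alpha> 0$. Assume moreover that $\hat u$, $A(\hat u)$ and their first $k$ spatial derivatives are integrable enough that all the sums over $i\in\mathbb Z$ below (and in the admissibility condition) converge absolutely for a.e. $t$ and are integrable in $t$. Then $$\|\hat u(\cdot,T)\|_{L^2(\mathbb R)}^2+2\Gamma_T[\hat u]+b\,c_\lambda\int_0^T|\hat u(\cdot,t)|^2_{H^{\lambda/2}(\mathbb R)}\,dt\le \|u_0\|^2_{L^2(\mathbb R)},$$ where $$\Gamma_T[u]=(1-\gamma)\int_0^T\sum_{i\in\mathbb Z}\int_{I_i}a(u)(u_x)^2\,dx\,dt+\alpha\int_0^T\sum_{i\in\mathbb Z}\frac{[A(u_i)]}{\Delta x}[u_i]\,dt\ (\ge 0).$$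
   Context: Problem: $u_t+f(u)_x=(a(u)u_x)_x+b\mathcal L[u]$ on $\mathbb R\times(0,T)$, $u(\cdot,0)=u_0\in L^2(\mathbb R)$, where $f,a:\mathbb R\to\mathbb R$ are Lipschitz, $a\ge0$ bounded, $f(0)=0$, $b\ge 0$, $A(u)=\int_0^u a(s)\,ds$. For $\lambda\in(0,1)$, $c_\lambda>0$, the fractional Laplacian is $\mathcal L[u](x)=c_\lambda\int_{|z|>0}\frac{u(x+z)-u(x)}{|z|^{1+\lambda}}dz$. The seminorm is $|u|^2_{H^{\lambda/2}(\mathbb R)}=\int_{\mathbb R}\int_{\mathbb R}\frac{(u(z)-u(x))^2}{|z-x|^{1+\lambda}}dz\,dx$, and for $u,v\in H^{\lambda/2}(\mathbb R)$ the integral $\int v\,\mathcal L[u]$ is understood as $-\frac{c_\lambda}{2}\int\int\frac{(v(z)-v(x))(u(z)-u(x))}{|z-x|^{1+\lambda}}dz\,dx$ (every element of $V^k\cap L^2(\mathbb R)$ lies in $H^{\lambda/2}(\mathbb R)$). Grid: $x_i=i\Delta x$, $I_i=(x_i,x_{i+1})$, $i\in\mathbb Z$; $V^k$ is the space of functions whose restriction to each $I_i$ is a polynomial of degree $\le k$. For piecewise smooth $p$: $p_i^\pm=p(x_i^\pm)$ (one-sided limits), $[p_i]=p(x_i^+)-p(x_i^-)$, $\overline{p_i}=\frac12(p(x_i^+)+p(x_i^-))$. Convective flux: $\hat f(u_i)=\hat f(u_i^-,u_i^+)$ where $\hat f:\mathbb R^2\to\mathbb R$ is Lipschitz, consistent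 ($\hat f(u,u)=f(u)$), nondecreasing in its first and nonincreasing in its second argument. Diffusive flux: $\hat h(u_i)=\beta_0\frac{[A(u_i)]}{\Delta x}+\overline{A(u_i)_x}+\sum_{m=1}^{\lfloor k/2\rfloor}\beta_m\Delta x^{2m-1}[\partial_x^{2m}A(u_i)]$ with real weights $\beta_m$ (and $a$ smooth enough for the derivatives to make sense), satisfying the admissibility condition: there exist $\gamma\in(0,1)$, $\alpha\ge0$ such that for all admissible $u\in V^k$, $\sum_i\hat h(u_i)[u_i]\ge\alpha\sum_i\frac{[A(u_i)]}{\Delta x}[u_i]-\gamma\sum_i\int_{I_i}a(u)(u_x)^2$. DDG method: find $\hat u(\cdot,t)\in V^k$ such that for every $i\in\mathbb Z$ and every polynomial $v$ of degree $\le k$ on $I_i$, $\int_{I_i}\hat u_tv-\int_{I_i}f(\hat u)v_x+\hat f(\hat u_{i+1})v_{i+1}^--\hat f(\hat u_i)v_i^++\int_{I_i}a(\hat u)\hat u_xv_x-\hat h(\hat u_{i+1})v_{i+1}^-+\hat h(\hat u_i)v_i^+=b\int_{I_i}\mathcal L[\hat u]v$, with initial condition $\int_{I_i}\hat u(x,0)v(x)dx=\int_{I_i}u_0(x)v(x)dx$. *)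

(* Defs.v *)
From HB Require Import structures.
From mathcomp Require Import all_boot all_order all_algebra.
From mathcomp Require Import all_classical all_reals all_analysis.
Set Implicit Arguments. Unset Strict Implicit. Unset Printing Implicit Defensive.
Import Order.TTheory GRing.Theory Num.Theory.
Import numFieldNormedType.Exports.
Local Open Scope classical_set_scope.
Local Open Scope ring_scope.

Section DDG.
Variable R : realType.
Local Notation mu := (@lebesgue_measure R).

Definition zsummable (F : int -> R) : Prop :=
  cvgn (series (fun n : nat => `|F (Posz n)| + `|F (Negz n)|)).
Definition zsum (F : int -> R) : R :=
  limn (series (fun n : nat => F (Posz n) + F (Negz n))).

Definition node (dx : R) (i : int) : R := i%:~R * dx.
Definition cell (dx : R) (i : int) : set R := `](node dx i), (node dx (i + 1))[.

(* an element of V^k given by its polynomial pieces P i on I_i *)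
Definition inVk (k : nat) (P : int -> {poly R}) : Prop :=
  forall i, (size (P i) <= k.+1)%N.

(* the function on R represented by the pieces P (value at the nodes,
   a null set, taken from the right cell) *)
Definition pw (dx : R) (P : int -> {poly R}) (x : R) : R :=
  (P (Num.floor (x / dx))).[x].

Definition cellfun (dx : R) (i : int) (q : {poly R}) (x : R) : R :=
  if x \in cell dx i then q.[x] else 0.

Definition Aof (a : R -> R) (u : R) : R :=
  if 0 <= u then \int[mu]_(s in `[0, u]) a s
  else - \int[mu]_(s in `[u, 0]) a s.

Definition trm dx (P : int -> {poly R}) i := (P (i - 1)).[node dx i].
Definition trp dx (P : int -> {poly R}) i := (P i).[node dx i].
Definition jump dx (P : int -> {poly R}) i := trp dx P i - trm dx P i.

Definition DA (a : R -> R) (n : nat) (p : {poly R}) (y : R) : R :=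
  derive1n n (fun x => Aof a p.[x]) y.

Definition jumpA a dx (P : int -> {poly R}) i :=
  Aof a (trp dx P i) - Aof a (trm dx P i).

Definition hflux (a : R -> R) (beta : nat -> R) (k : nat) (dx : R)
    (P : int -> {poly R}) (i : int) : R :=
  beta 0%N * jumpA a dx P i / dx
  + (DA a 1 (P i) (node dx i) + DA a 1 (P (i - 1)) (node dx i)) / 2
  + \sum_(1 <= m < (k./2).+1)
      beta m * dx ^+ (2 * m).-1 *
      (DA a (2 * m) (P i) (node dx i) - DA a (2 * m) (P (i - 1)) (node dx i)).

Definition term_h a beta k dx P i := hflux a beta k dx P i * jump dx P i.
Definition term_A a dx P i := jumpA a dx P i / dx * jump dx P i.
Definition term_a (a : R -> R) dx (P : int -> {poly R}) i :=
  \int[mu]_(x in cell dx i) (a (P i).[x] * ((P i)^`()).[x] ^+ 2).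

Definition admissible (a : R -> R) (beta : nat -> R) (k : nat) (dx : R)
    (gamma alpha : R) : Prop :=
  forall P : int -> {poly R}, inVk k P ->
    zsummable (term_h a beta k dx P) ->
    zsummable (term_A a dx P) ->
    zsummable (term_a a dx P) ->
    alpha * zsum (term_A a dx P) - gamma * zsum (term_a a dx P)
      <= zsum (term_h a beta k dx P).

Definition L2sq (g : R -> R) : \bar R := (\int[mu]_x ((g x) ^+ 2)%:E)%E.

Definition kernel (lam : R) (x z : R) : R := `|z - x| `^ (1 + lam).

Definition Hsemi2 (lam : R) (u : R -> R) : \bar R :=
  (\int[mu]_x \int[mu]_z (((u z - u x) ^+ 2) / kernel lam x z)%:E)%E.

(* int v L[u] := -(c/2) int int (v(z)-v(x))(u(z)-u(x))/|z-x|^{1+lam} dz dx *)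
Definition fracform (c lam : R) (v u : R -> R) : R :=
  - (c / 2) * \int[(mu \x mu)%E]_(p in setT)
      ((v p.2 - v p.1) * (u p.2 - u p.1) / kernel lam p.1 p.2).

Definition GammaT (a : R -> R) (dx gamma alpha T : R)
    (P : int -> R -> {poly R}) : R :=
  (1 - gamma) * \int[mu]_(t in `[0, T]) zsum (term_a a dx (P^~ t))
  + alpha * \int[mu]_(t in `[0, T]) zsum (term_A a dx (P^~ t)).

End DDG.

(* Main.v *)
Require Import Defs.
From HB Require Import structures.
From mathcomp Require Import all_boot all_order all_algebra.
From mathcomp Require Import all_classical all_reals all_analysis.
From mathcomp Require Import measurable_realfun ring lra zify.
Import Order.TTheory GRing.Theory Num.Theory.
Import numFieldNormedType.Exports.
Local Open Scope classical_set_scope.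
Local Open Scope ring_scope.

(** Testing the scheme with the solution itself on each cell and summing by
    parts, the convective flux contributes a nonnegative entropy term at each
    node (monotonicity of the flux and the mean value theorem for a primitive
    of [f]), the diffusive terms are controlled by admissibility, and the
    nonlocal term sums to the Gagliardo form.  Two points are not routine.

    Every square-integrable piecewise polynomial of degree at most [k] has
    finite [H^(lam/2)] seminorm, bounded by its L^2 norm: inverse inequalities
    handle two points of the same cell, and two points of different cells are
    handled by integrating the kernel away from the cell.

    Boundary terms in the summation by parts vanish along a subsequence.
    Testing with the indicator of [N] consecutive cells shows that the total
    numerical flux at distance [N] is [O(sqrt N)], while the traces are square
    summable over the nodes, so that [N |u_N|^2] has lower limit [0].  This
    requires no regularity of [a] near [0].

    The resulting differential inequality for the squared L^2 norm is then
    integrated in time. *)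

Set Implicit Arguments. Unset Strict Implicit. Unset Printing Implicit Defensive.

(** * Square-integrable functions *)

(** Summability is assumed only for [term_h], [term_A] and [term_a], so the diffusive flux is
    controlled only when multiplied by a jump. Summation by parts leaves it multiplied by a single
    trace, and it contains nodal derivatives of [A(u)] on which no bound is assumed. The flux is
    therefore estimated through the scheme, not through its formula. Growth like sqrt N is just
    affordable: if [N |u_N|^2] stayed above a positive number, the squared traces would dominate a
    multiple of the harmonic series.

    Convergence of the cellwise nonlocal terms is not assumed either. It follows from the bound of
    the seminorm by the L^2 norm, which also shows that the nonlocal energy of an indicator grows at
    most linearly with the number of cells, and that the seminorm of the solution is continuous in
    time.

    The nonlocal form is treated as an inner product on the plane, between weighted differences, so
    one set of Hilbert space lemmas serves both for it and for functions on the line. *)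

Lemma discriminant_le (R : realFieldType) (A B D : R) :
  (forall s, 0 <= A + 2 * s * B + s ^+ 2 * D) -> B ^+ 2 <= A * D.
Proof.
move=> H; have [D0|D0|D0] := ltgtP D 0.
- exfalso; have A0 : 0 <= A by have := H 0; lra.
  (* Adding the values at [s] and [- s] removes the linear term, and [s] is so large that
     [s ^+ 2 * D <= - (1 + A)]. *)
  have := H ((1 + A) / - D + 1); have := H (- ((1 + A) / - D + 1)).
  set s := _ / _ + 1.
  have s1 : 1 <= s by rewrite lerDr divr_ge0 ?oppr_ge0 ?ltW// ltr_wpDr.
  have sD : s * D <= - (1 + A).
    rewrite /s mulrDl mul1r invrN mulrN mulNr divfK ?lt_eqF//; lra.
  rewrite sqrrN => ? ?.
  have : s ^+ 2 * D <= - (1 + A).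
    rewrite expr2 -mulrA; have ? : s * D <= 0 by lra.
    by apply: le_trans sD; nra.
  lra.
- have := H (- B / D).
  have -> : A + 2 * (- B / D) * B + (- B / D) ^+ 2 * D = (A * D - B ^+ 2) / D.
    by field; rewrite gt_eqF.
  by rewrite pmulr_lge0 ?invr_gt0// subr_ge0.
- subst D; rewrite mulr0; have [->|B0] := eqVneq B 0; first by rewrite expr0n.
  have := H (- (A + 1) / (2 * B)); rewrite mulr0 addr0.
  have -> : A + 2 * (- (A + 1) / (2 * B)) * B = - 1 by field.
  lra.
Qed.

Section square_integrable.
Context d (T : measurableType d) (R : realType) (m : {measure set T -> \bar R}).
Implicit Types f g h : T -> R.

(** The measure is arbitrary because it will be both Lebesgue measure on the line and its square on
    the plane. *)
Definition sqint f :=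
  measurable_fun setT f /\ (\int[m]_x ((f x) ^+ 2)%:E < +oo)%E.

Definition ip f g : R := \int[m]_x (f x * g x).

Lemma sqint_integrable_sqr f : sqint f ->
  m.-integrable setT (EFin \o (fun x => f x ^+ 2)).
Proof.
move=> [mf fo]; apply/integrableP; split.
  by apply/measurable_EFinP; exact: measurable_funX.
by under eq_integral do rewrite /= ger0_norm ?sqr_ge0//.
Qed.

Lemma sqint_integrableM f g : sqint f -> sqint g ->
  m.-integrable setT (EFin \o (fun x => f x * g x)).
Proof.
move=> sf sg.
apply: (le_integrable measurableT _ _
  (integrableD measurableT (sqint_integrable_sqr sf) (sqint_integrable_sqr sg))).
  by apply/measurable_EFinP; apply: measurable_funM; [case: sf|case: sg].
move=> x _ /=; rewrite lee_fin [leRHS]ger0_norm ?addr_ge0 ?sqr_ge0//.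
by rewrite ler_norml; apply/andP; split; nra.
Qed.

Lemma sqintD f g : sqint f -> sqint g -> sqint (fun x => f x + g x).
Proof.
move=> sf sg; split.
  by apply: measurable_funD; [case: sf|case: sg].
have I := integrableZl measurableT 2
  (integrableD measurableT (sqint_integrable_sqr sf) (sqint_integrable_sqr sg)).
have J : m.-integrable setT (EFin \o (fun x => (f x + g x) ^+ 2)).
  apply: (le_integrable measurableT _ _ I).
    by apply/measurable_EFinP; apply: measurable_funX;
      apply: measurable_funD; [case: sf|case: sg].
  move=> x _ /=; rewrite lee_fin ger0_norm ?sqr_ge0//.
  apply: le_trans (ler_norm _).
  by have := sqr_ge0 (f x - g x); nra.
apply: le_lt_trans (integrableP _ _ _ J).2.
by under [leRHS]eq_integral do rewrite /= ger0_norm ?sqr_ge0//.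
Qed.

Lemma sqintZ k f : sqint f -> sqint (fun x => k * f x).
Proof.
move=> sf; split; first by apply: measurable_funM => //; case: sf.
have [mf fo] := sf.
under eq_integral do rewrite exprMn EFinM.
rewrite ge0_integralZl_EFin ?sqr_ge0//.
- by rewrite lte_mul_pinfty ?lee_fin ?sqr_ge0.
- by move=> x _; rewrite lee_fin sqr_ge0.
- by apply/measurable_EFinP; exact: measurable_funX.
Qed.

Lemma sqintB f g : sqint f -> sqint g -> sqint (fun x => f x - g x).
Proof.
move=> sf sg; have := sqintD sf (sqintZ (- 1) sg).
by congr sqint; apply/funext => x; rewrite mulN1r.
Qed.

Lemma ipC f g : ip f g = ip g f.
Proof. by apply: eq_Rintegral => x _; rewrite mulrC. Qed.

Lemma ipDl f g h : sqint f -> sqint g -> sqint h ->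
  ip (fun x => f x + g x) h = ip f h + ip g h.
Proof.
move=> sf sg sh; rewrite /ip -RintegralD//; [|exact: sqint_integrableM..].
by apply: eq_Rintegral => x _; rewrite mulrDl.
Qed.

Lemma ipZl k f h : sqint f -> sqint h ->
  ip (fun x => k * f x) h = k * ip f h.
Proof.
move=> sf sh; rewrite /ip -RintegralZl//; last exact: sqint_integrableM.
by apply: eq_Rintegral => x _; rewrite mulrA.
Qed.

Lemma ipBl f g h : sqint f -> sqint g -> sqint h ->
  ip (fun x => f x - g x) h = ip f h - ip g h.
Proof.
move=> sf sg sh; rewrite /ip -RintegralB//; [|exact: sqint_integrableM..].
by apply: eq_Rintegral => x _; rewrite mulrBl.
Qed.

Lemma ip_ge0 f : 0 <= ip f f.
Proof. by apply: Rintegral_ge0 => x _; rewrite -expr2 sqr_ge0. Qed.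

Lemma ipE f : sqint f -> (\int[m]_x ((f x) ^+ 2)%:E)%E = (ip f f)%:E.
Proof.
move=> sf; rewrite /ip /Rintegral fineK.
  by apply: eq_integral => x _; rewrite expr2.
by apply: integrable_fin_num => //; exact: sqint_integrableM.
Qed.

Lemma ip_sqrD s f g : sqint f -> sqint g ->
  ip (fun x => f x + s * g x) (fun x => f x + s * g x)
  = ip f f + 2 * s * ip f g + s ^+ 2 * ip g g.
Proof.
move=> sf sg; have sg' := sqintZ s sg; have sD := sqintD sf sg'.
rewrite ipDl// ipZl// (ipC f) (ipC g) ipDl// ipDl// !ipZl// (ipC g f); ring.
Qed.

Lemma ip_CauchySchwarz f g : sqint f -> sqint g ->
  ip f g ^+ 2 <= ip f f * ip g g.
Proof.
move=> sf sg; apply: discriminant_le => s.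
by rewrite -ip_sqrD//; exact: ip_ge0.
Qed.

End square_integrable.

(** * Inverse inequalities for polynomials *)

Section integrals_on_intervals.
Variable R : realType.
Local Notation mu := (@lebesgue_measure R).

Lemma continuous_integrable_oo (f : R -> R) (a b : R) : continuous f ->
  mu.-integrable `]a, b[ (EFin \o f).
Proof.
move=> cf; apply: (@integrableS _ _ _ mu `[a, b]%classic) => //.
  exact: subset_itv_oo_cc.
apply: continuous_compact_integrable; first exact: segment_compact.
by apply: continuous_subspaceT => x; exact: cf.
Qed.

Lemma Rintegral_oo_FTC2 (f F : R -> R) (a b : R) : a < b -> continuous f ->
  (forall x, x \in `[a, b] -> is_derive x 1 F (f x)) ->
  \int[mu]_(x in `]a, b[) f x = F b - F a.
Proof.
move=> ab cf dF.
have cF x : x \in `[a, b] -> {for x, continuous F}.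
  by move=> /dF dFx; apply: differentiable_continuous; apply/derivable1_diffP.
have aI : a \in `[a, b] by rewrite in_itv/= lexx ltW.
have bI : b \in `[a, b] by rewrite in_itv/= lexx ltW.
rewrite /Rintegral -(@integral_itv_bndoo _ a b _ true false); last first.
  by apply/measurable_EFinP; apply: measurable_funS (continuous_measurable_fun cf).
rewrite (@continuous_FTC2 _ f F)//.
- by apply: continuous_subspaceT => x; exact: cf.
- split=> [x xab| |].
  + by have [] := dF x (subset_itv_oo_cc xab).
  + by apply: cvg_at_right_filter; exact: cF.
  + by apply: cvg_at_left_filter; exact: cF.
- move=> x xab; rewrite derive1E.
  by have dFx := dF x (subset_itv_oo_cc xab); rewrite derive_val.
Qed.

(** The coefficient at [i = 0] is a division by zero, hence 0, so the constant of integration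
    vanishes. *)
Definition poly_primitive (p : {poly R}) : {poly R} :=
  \poly_(i < (size p).+1) (p`_i.-1 / i%:R).

Lemma deriv_primitive p : (poly_primitive p)^`() = p.
Proof.
apply/polyP => i; rewrite coef_deriv coef_poly ltnS /=.
case: ltnP => [_|ip]; last by rewrite mul0rn nth_default.
by rewrite -[LHS]mulr_natr divfK// pnatr_eq0.
Qed.

Lemma Rintegral_poly (p : {poly R}) (a b : R) : a < b ->
  \int[mu]_(x in `]a, b[) p.[x] = (poly_primitive p).[b] - (poly_primitive p).[a].
Proof.
move=> ab; apply: Rintegral_oo_FTC2 => //; first exact: continuous_horner.
by move=> x _; rewrite -{2}(deriv_primitive p); exact: is_derive_poly.
Qed.

Lemma Rintegral_polyE (F : {poly R}) (a b : R) : a < b ->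
  \int[mu]_(x in `]a, b[) F^`().[x] = F.[b] - F.[a].
Proof.
move=> ab; apply: (@Rintegral_oo_FTC2 _ (horner F)) => //.
exact: continuous_horner.
Qed.

Lemma Rintegral_poly_shift (p : {poly R}) (x0 D : R) : 0 < D ->
  \int[mu]_(x in `]x0, x0 + D[) p.[x]
  = \int[mu]_(x in `]0, D[) (p \Po ('X + x0%:P)).[x].
Proof.
move=> D0; rewrite Rintegral_poly ?ltrDl//.
have -> : p \Po ('X + x0%:P) = (poly_primitive p \Po ('X + x0%:P))^`().
  by rewrite deriv_comp deriv_primitive derivD derivX derivC addr0 mulr1.
by rewrite Rintegral_polyE// !horner_comp !hornerE (addrC D).
Qed.

(** A primitive of [p ^+ 2] is nondecreasing on [[0, D]] and takes the same value at both ends, so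
    it is constant there. A polynomial constant on an interval is constant, and its derivative
    [p ^+ 2] vanishes. *)
Lemma Rintegral_sqr_eq0 (p : {poly R}) (D : R) : 0 < D ->
  \int[mu]_(x in `]0, D[) (p ^+ 2).[x] = 0 -> p = 0.
Proof.
move=> D0; rewrite Rintegral_poly//; set F := poly_primitive (p ^+ 2) => FD.
have Fnd (x y : R) : 0 <= x -> x <= y -> y <= D -> F.[x] <= F.[y].
  rewrite le_eqVlt => /predU1P[<-|x0].
    rewrite le_eqVlt => /predU1P[<-//|y0 _].
    rewrite -subr_ge0 -Rintegral_poly//; apply: Rintegral_ge0 => z _.
    by rewrite horner_exp sqr_ge0.
  rewrite le_eqVlt => /predU1P[<-//|xy _].
  rewrite -subr_ge0 -Rintegral_poly//; apply: Rintegral_ge0 => z _.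
  by rewrite horner_exp sqr_ge0.
have F0 x : 0 <= x <= D -> F.[x] = F.[0].
  move=> /andP[x0 xD]; apply/le_anti/andP; split; last exact: Fnd.
  by rewrite (le_trans (Fnd _ _ x0 xD _))// -subr_le0 FD.
have Fc : F - F.[0]%:P = 0.
  apply/eqP; rewrite -size_poly_eq0 -leqn0.
  (* Distinct roots in []0, D]], as many as the size of the polynomial, hence more than its degree
     allows. *)
  pose s := [seq D / (i.+1)%:R | i <- iota 0 (size (F - F.[0]%:P))].
  have := @max_poly_roots _ (F - F.[0]%:P) s.
  have [->|nz] := eqVneq (F - F.[0]%:P) 0; first by rewrite size_poly0.
  move=> /(_ isT); rewrite size_map size_iota ltnn => H; exfalso.
  suff : false by []. apply: H.
    apply/allP => _ /mapP[i _ ->]; rewrite rootE !hornerE subr_eq0; apply/eqP.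
    apply: F0; rewrite divr_ge0 ?(ltW D0)//= ler_pdivrMr ?ltr0n//.
    by rewrite ler_peMr ?(ltW D0)// ler1n.
  rewrite map_inj_uniq ?iota_uniq// => i j /(mulfI (lt0r_neq0 D0)) /invr_inj.
  by move=> /eqP; rewrite eqr_nat eqSS => /eqP.
have := congr1 (@deriv R) Fc; rewrite derivB derivC subr0 deriv0 deriv_primitive.
by move=> /eqP; rewrite expf_eq0 => /eqP.
Qed.

End integrals_on_intervals.

Section inverse_inequality.
Variable R : realType.
Local Notation mu := (@lebesgue_measure R).
Variables (k : nat) (D : R).
Hypothesis D0 : 0 < D.

Let I (p : {poly R}) : R := \int[mu]_(x in `]0, D[) p.[x].

Let I_int (p : {poly R}) : mu.-integrable `]0, D[ (EFin \o horner p).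
Proof. by apply: continuous_integrable_oo; exact: continuous_horner. Qed.

Let ID p q : I (p + q) = I p + I q.
Proof.
rewrite /I -RintegralD//; [|exact: I_int..].
by apply: eq_Rintegral => x _; rewrite hornerD.
Qed.

Let IZ c p : I (c *: p) = c * I p.
Proof.
rewrite /I -(RintegralZl c _ (I_int p))//.
by apply: eq_Rintegral => x _; rewrite hornerZ.
Qed.

Let I0 : I 0 = 0.
Proof. by rewrite -(scale0r (0 : {poly R})) IZ mul0r. Qed.

Let Isum n (F : 'I_n -> {poly R}) : I (\sum_i F i) = \sum_i I (F i).
Proof. exact: (big_morph I ID I0). Qed.

Let I_ge0 p : 0 <= I (p ^+ 2).
Proof. by apply: Rintegral_ge0 => x _; rewrite horner_exp sqr_ge0. Qed.

Let I_CS p q : I (p * q) ^+ 2 <= I (p ^+ 2) * I (q ^+ 2).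
Proof.
apply: discriminant_le => s.
have -> : I (p ^+ 2) + 2 * s * I (p * q) + s ^+ 2 * I (q ^+ 2)
    = I ((p + s *: q) ^+ 2).
  rewrite -!IZ -!ID; congr I.
  by rewrite -!mul_polyC !polyCM (rmorph_nat (@polyC R) 2); ring.
exact: I_ge0.
Qed.

(* The Gram matrix of the monomials is invertible, so the coefficients are
   fixed linear combinations of the moments, which Cauchy-Schwarz controls. *)
Let G : 'M[R]_k.+1 := \matrix_(i, j) I ('X^i * 'X^j).

Let moments (c : 'rV[R]_k.+1) : c *m G = \row_j I (rVpoly c * 'X^j).
Proof.
apply/rowP => j; rewrite !mxE.
have -> : rVpoly c = \sum_(i < k.+1) c 0 i *: 'X^i.
  rewrite /rVpoly poly_def; apply: eq_bigr => i _; congr (_ *: _).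
  by case: insubP => [i' _ /val_inj ->//|]; rewrite ltn_ord.
rewrite mulr_suml Isum; apply: eq_bigr => i _.
by rewrite mxE -scalerAl IZ.
Qed.

(** A vector in the kernel gives a polynomial orthogonal to all monomials of degree at most [k],
    hence to itself. *)
Let G_unit : G \in unitmx.
Proof.
rewrite -row_free_unit; apply: inj_row_free => c; rewrite moments => /rowP cG.
have : I (rVpoly c ^+ 2) = 0.
  rewrite expr2 [X in _ * X](_ : _ = \sum_(i < k.+1) c 0 i *: 'X^i).
    rewrite mulr_sumr Isum big1// => i _.
    by have := cG i; rewrite !mxE -scalerAr IZ => ->; rewrite mulr0.
  rewrite /rVpoly poly_def; apply: eq_bigr => i _; congr (_ *: _).
  by case: insubP => [i' _ /val_inj ->//|]; rewrite ltn_ord.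
move/(Rintegral_sqr_eq0 D0) => c0.
by rewrite -(rVpolyK c) c0 linear0.
Qed.

Let coef_bound : exists2 C : R, 0 <= C & forall (p : {poly R}) l,
  (size p <= k.+1)%N -> `|p`_l| <= C * Num.sqrt (I (p ^+ 2)).
Proof.
pose C := \sum_(l < k.+1) \sum_(j < k.+1)
  Num.sqrt (I ('X^j ^+ 2)) * `|(invmx G) j l|.
have C0 : 0 <= C.
  by apply: sumr_ge0 => l _; apply: sumr_ge0 => j _; rewrite mulr_ge0// sqrtr_ge0.
exists C => // p l sp.
have [ll|ll] := ltnP l k.+1; last first.
  by rewrite nth_default ?normr0 ?mulr_ge0 ?sqrtr_ge0// (leq_trans sp).
pose c : 'rV[R]_k.+1 := poly_rV p.
have cE : c = (\row_j I (p * 'X^j)) *m invmx G.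
  by rewrite -{1}(mulmxK G_unit c) moments /c poly_rV_K.
have -> : p`_l = c 0 (Ordinal ll) by rewrite mxE.
rewrite cE mxE (le_trans (ler_norm_sum _ _ _))//.
rewrite /C mulr_suml [leRHS](bigD1 (Ordinal ll))//= ler_wpDr//.
  apply: sumr_ge0 => i _; apply: mulr_ge0; last exact: sqrtr_ge0.
  by apply: sumr_ge0 => j _; apply: mulr_ge0 => //; exact: sqrtr_ge0.
rewrite mulr_suml; apply: ler_sum => j _; rewrite mxE normrM mulrAC.
rewrite ler_wpM2r// -sqrtrM// -sqrtr_sqr ler_wsqrtr// mulrC.
exact: I_CS.
Qed.

(** The base [1 + D] is at least 1, so its powers increase with the exponent and a single constant
    serves all [n <= k]. *)
Let pow_bound (y : R) n : 0 <= y <= D -> (n <= k)%N -> y ^+ n <= (1 + D) ^+ k.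
Proof.
move=> /andP[y0 yD] nk; apply: (@le_trans _ _ ((1 + D) ^+ n)).
  by rewrite lerXn2r ?nnegrE//; lra.
by rewrite ler_weXn2l//; lra.
Qed.

Let pow_lip (y z : R) n : 0 <= y <= D -> 0 <= z <= D -> (n <= k)%N ->
  `|z ^+ n - y ^+ n| <= k.+1%:R * (1 + D) ^+ k * `|z - y|.
Proof.
move=> yD zD nk; rewrite subrXX normrM mulrC ler_wpM2r//.
rewrite (le_trans (ler_norm_sum _ _ _))//.
apply: (@le_trans _ _ (\sum_(i < n) (1 + D) ^+ k)).
  apply: ler_sum => i _; rewrite normrM !normrX.
  have /andP[y0 y1] := yD; have /andP[z0 z1] := zD.
  rewrite !ger0_norm//.
  apply: (@le_trans _ _ ((1 + D) ^+ (n.-1 - i) * (1 + D) ^+ i)).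
    by apply: ler_pM; rewrite ?exprn_ge0// lerXn2r ?nnegrE//; lra.
  rewrite -exprD subnK; last by rewrite -ltnS prednK// (leq_ltn_trans _ (ltn_ord i)).
  by apply: ler_weXn2l; [lra|rewrite (leq_trans (leq_pred _))].
rewrite sumr_const card_ord -[leLHS]mulr_natl ler_wpM2r ?exprn_ge0//; first lra.
by rewrite ler_nat (leq_trans nk).
Qed.

(** Translation to []0, D[] makes [C] independent of [x0], hence common to all cells. The first
    bound controls traces and the interaction of different cells; the second compensates the
    singularity of the kernel inside a cell. *)
Lemma inverse_inequality : exists2 C : R, 0 <= C &
  forall (x0 : R) (p : {poly R}), (size p <= k.+1)%N ->
  let N := \int[mu]_(x in `]x0, x0 + D[) (p.[x] ^+ 2) in
  (forall x, x0 <= x <= x0 + D -> p.[x] ^+ 2 <= C * N) /\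
  (forall x z, x0 <= x <= x0 + D -> x0 <= z <= x0 + D ->
    (p.[z] - p.[x]) ^+ 2 <= C * N * (z - x) ^+ 2).
Proof.
have [B B0 HB] := coef_bound.
have D1 : 0 <= 1 + D by rewrite addr_ge0// ltW.
pose M : R := k.+1%:R * (1 + D) ^+ k.
have M1 : (1 + D) ^+ k <= M.
  by apply: ler_peMl; [apply: exprn_ge0|rewrite ler1n].
have M0 : 0 <= M by apply: le_trans M1; apply: exprn_ge0.
(* There are [k.+1] coefficients, each at most [B] times the L^2 norm, and [M] bounds both the size
   and the Lipschitz constant of every monomial. *)
exists ((k.+1%:R * B * M) ^+ 2); first exact: sqr_ge0.
move=> x0 p sp N.
pose q := p \Po ('X + x0%:P).
have sq : (size q <= k.+1)%N by rewrite size_comp_poly2 ?size_XaddC.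
have NE : N = I (q ^+ 2).
  have -> : N = \int[mu]_(x in `]x0, x0 + D[) (p ^+ 2).[x].
    by apply: eq_Rintegral => x _; rewrite horner_exp.
  rewrite Rintegral_poly_shift// /I; apply: eq_Rintegral => x _.
  by rewrite horner_comp !horner_exp horner_comp.
have N0 : 0 <= N by rewrite NE.
pose r := B * Num.sqrt N.
have r0 : 0 <= r by rewrite mulr_ge0// sqrtr_ge0.
have qE x : p.[x] = q.[x - x0] by rewrite horner_comp !hornerE subrK.
have shift x : x0 <= x <= x0 + D -> 0 <= x - x0 <= D by move=> /andP[? ?]; lra.
have r2 : (k.+1%:R * B * M) ^+ 2 * N = (k.+1%:R * r * M) ^+ 2.
  by rewrite /r !exprMn sqr_sqrtr//; ring.
have sqr_le (y z : R) : `|y| <= z -> y ^+ 2 <= z ^+ 2.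
  move=> yz; rewrite -[leLHS]real_normK ?num_real// lerXn2r ?nnegrE//.
  exact: le_trans yz.
split=> [x xD|x z xD zD].
  rewrite r2; apply: sqr_le; rewrite qE (horner_coef_wide _ sq) (le_trans (ler_norm_sum _ _ _))//.
  rewrite -mulrA mulr_natl -[X in _ *+ X]card_ord -sumr_const.
  apply: ler_sum => i _; rewrite normrM ler_pM// ?HB//.
    by rewrite /r NE; exact: HB.
  rewrite normrX ger0_norm; last by have /andP[] := shift _ xD.
  by rewrite (le_trans (pow_bound (shift _ xD) _))// -ltnS ltn_ord.
rewrite r2 -[(z - x) ^+ 2]real_normK ?num_real// -exprMn; apply: sqr_le.
rewrite !qE !(horner_coef_wide _ sq) -sumrB (le_trans (ler_norm_sum _ _ _))//.
rewrite -[_ * _ * `|z - x|]mulrA -[_ * _ * (_ * _)]mulrA mulr_natl -[X in _ *+ X]card_ord -sumr_const.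
apply: ler_sum => i _; rewrite -mulrBr normrM ler_pM//.
  by rewrite /r NE; exact: HB.
have -> : z - x = (z - x0) - (x - x0) by ring.
by apply: pow_lip; [exact: shift|exact: shift|rewrite -ltnS ltn_ord].
Qed.

End inverse_inequality.

(** * Integrals over the cells of the grid *)

Section grid.
Variables (R : realType) (dx : R).
Hypothesis dx0 : 0 < dx.
Local Notation mu := (@lebesgue_measure R).

(** Half-open cells partition the line and are the level sets of the floor in [pw]; they differ from
    the open cells by a null set. *)
Definition hcell (i : int) : set R := `[node dx i, node dx (i + 1)[.

(** The pairing of indices follows [zsum], so countable additivity gives series in the same
    order. *)
Definition bicell (n : nat) : set R := hcell (Posz n) `|` hcell (Negz n).

Lemma nodeS i : node dx (i + 1) = node dx i + dx.
Proof. by rewrite /node intrD mulrDl mul1r. Qed.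

Lemma cellE i : cell dx i = `]node dx i, node dx i + dx[%classic.
Proof. by rewrite /cell nodeS. Qed.

Lemma hcellP i x : hcell i x <-> Num.floor (x / dx) = i.
Proof.
rewrite /hcell /node /= in_itv/= -ler_pdivlMr// -ltr_pdivrMr//.
split; first by move=> h; apply: floor_def.
by move=> <-; apply: floor_itv; rewrite num_real.
Qed.

Lemma measurable_hcell i : measurable (hcell i).
Proof. exact: measurable_itv. Qed.

Lemma measurable_cell i : measurable (cell dx i).
Proof. exact: measurable_itv. Qed.

Arguments measurable_cell : clear implicits.

Lemma integrable_cell i (f : R -> \bar R) :
  mu.-integrable setT f -> mu.-integrable (cell dx i) f.
Proof.
exact: (@integrableS _ _ _ mu setT (cell dx i) f measurableT (measurable_cell i) (@subsetT _ _)).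
Qed.

Lemma measurable_bicell n : measurable (bicell n).
Proof. by apply: measurableU; exact: measurable_hcell. Qed.

Lemma hcell_disjoint i j : i != j -> [disjoint hcell i & hcell j].
Proof.
move=> ij; apply/eqP; rewrite -subset0 => x [/hcellP xi /hcellP xj].
by move: ij; rewrite -xi -xj eqxx.
Qed.

Lemma trivIset_bicell : trivIset setT bicell.
Proof.
by move=> n m _ _ [x [[] /hcellP xn [] /hcellP]]; rewrite xn => -[].
Qed.

Lemma bigcup_bicell : \bigcup_n bicell n = setT.
Proof.
apply/seteqP; split => // x _.
have := erefl (Num.floor (x / dx)); case: {2}(Num.floor _) => n /hcellP xn.
- by exists n => //; left.
- by exists n => //; right.
Qed.

Lemma measurable_cellwise d' (U : measurableType d') (F : int -> R -> U) :
  (forall i, measurable_fun setT (F i)) ->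
  measurable_fun setT (fun x : R => F (Num.floor (x / dx)) x).
Proof.
move=> mF; rewrite -bigcup_bicell.
apply/measurable_fun_bigcup => [n|n]; first exact: measurable_bicell.
have mFi i : measurable_fun (hcell i) (fun x : R => F (Num.floor (x / dx)) x).
  apply: (eq_measurable_fun (F i)) => [x|]; last exact: measurable_funTS.
  by rewrite inE => /hcellP ->.
by apply/measurable_funU; [exact: measurable_hcell..|split].
Qed.

Lemma measurable_pw P : measurable_fun setT (pw dx P).
Proof.
apply: (@measurable_cellwise _ _ (fun i => horner (P i))) => i.
by apply: continuous_measurable_fun; exact: continuous_horner.
Qed.

Lemma pw_hcell P i x : hcell i x -> pw dx P x = (P i).[x].
Proof. by rewrite /pw => /hcellP ->. Qed.

Lemma cell_hcell i : cell dx i `<=` hcell i.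
Proof. exact: subset_itv_oo_co. Qed.

Lemma pw_cell P i x : cell dx i x -> pw dx P x = (P i).[x].
Proof. by move=> /cell_hcell /pw_hcell. Qed.

Lemma integral_hcell i (f : R -> \bar R) : measurable_fun setT f ->
  (\int[mu]_(x in hcell i) f x = \int[mu]_(x in cell dx i) f x)%E.
Proof. by move=> mf; rewrite /hcell integral_itv_bndoo//; exact: measurable_funTS. Qed.

Lemma ge0_integral_bicell n (f : R -> \bar R) : measurable_fun setT f ->
  (forall x, (0 <= f x)%E) ->
  (\int[mu]_(x in bicell n) f x
   = \int[mu]_(x in cell dx (Posz n)) f x + \int[mu]_(x in cell dx (Negz n)) f x)%E.
Proof.
move=> mf f0; rewrite ge0_integral_setU//; first last.
- exact: hcell_disjoint.
- exact: measurable_funTS.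
- exact: measurable_hcell.
- exact: measurable_hcell.
by rewrite !integral_hcell.
Qed.

Lemma ge0_integral_cells (f : R -> \bar R) : measurable_fun setT f ->
  (forall x, (0 <= f x)%E) ->
  (\int[mu]_x f x = \sum_(n <oo) (\int[mu]_(x in cell dx (Posz n)) f x
                                + \int[mu]_(x in cell dx (Negz n)) f x))%E.
Proof.
move=> mf f0; rewrite -bigcup_bicell ge0_integral_bigcup//.
- by apply: eq_eseriesr => n _; exact: ge0_integral_bicell.
- exact: measurable_bicell.
- by rewrite bigcup_bicell.
- exact: trivIset_bicell.
Qed.

Lemma ge0_le_integral_cells (f g : R -> \bar R) :
  measurable_fun setT f -> measurable_fun setT g ->
  (forall x, (0 <= f x)%E) -> (forall x, (0 <= g x)%E) ->
  (forall i, (\int[mu]_(x in cell dx i) f x <= \int[mu]_(x in cell dx i) g x)%E) ->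
  (\int[mu]_x f x <= \int[mu]_x g x)%E.
Proof.
move=> mf mg f0 g0 fg; rewrite !ge0_integral_cells//.
apply: lee_nneseries => n _; last exact: leeD.
by move=> _; rewrite adde_ge0// integral_ge0.
Qed.

Lemma ge0_integrable_cells_cvg (f : R -> R) : (forall x, 0 <= f x) ->
  mu.-integrable setT (EFin \o f) ->
  series (fun n => \int[mu]_(x in cell dx (Posz n)) f x
                 + \int[mu]_(x in cell dx (Negz n)) f x) @ \oo --> \int[mu]_x f x.
Proof.
move=> f0 fi; have mf := measurable_int _ fi.
have fC i : (\int[mu]_(x in cell dx i) (f x)%:E
             = (\int[mu]_(x in cell dx i) f x)%:E)%E.
  by rewrite fineK//; by apply: integrable_fin_num; [exact: measurable_cell|exact: integrable_cell].
have fT : (\int[mu]_x (f x)%:E = (\int[mu]_x f x)%:E)%E.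
  by rewrite fineK//; exact: integrable_fin_num.
pose u n := \int[mu]_(x in cell dx (Posz n)) f x
          + \int[mu]_(x in cell dx (Negz n)) f x.
apply: (@fine_cvg _ _ _ _ (EFin \o series u)); rewrite -fT.
rewrite (@ge0_integral_cells (EFin \o f)); [|exact: mf|by move=> x /=; rewrite lee_fin].
under eq_eseriesr do rewrite !fC -EFinD.
apply: (@cvg_trans _ (eseries (EFin \o u) @ \oo)).
  apply: near_eq_cvg; apply: nearW => n.
  by rewrite /eseries /series /= sumEFin.
apply: is_cvg_nneseries => n _ _; rewrite lee_fin addr_ge0//.
  exact: Rintegral_ge0.
exact: Rintegral_ge0.
Qed.

(** The splitting [f = (|f| + f) - |f|] reduces the signed case to two nonnegative ones. *)
Lemma integrable_cells_cvg (f : R -> R) : mu.-integrable setT (EFin \o f) ->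
  series (fun n => \int[mu]_(x in cell dx (Posz n)) f x
                 + \int[mu]_(x in cell dx (Negz n)) f x) @ \oo --> \int[mu]_x f x.
Proof.
move=> fi; have ni : mu.-integrable setT (EFin \o (fun x => `|f x|)).
  exact: integrable_norm fi.
have gi : mu.-integrable setT (EFin \o (fun x => `|f x| + f x)).
  exact: (integrableD measurableT ni fi).
have cg : forall x, 0 <= `|f x| + f x.
  by move=> x; rewrite -lerBlDr sub0r -normrN ler_norm.
pose s (h : R -> R) n := \int[mu]_(x in cell dx (Posz n)) h x
                      + \int[mu]_(x in cell dx (Negz n)) h x.
have -> : series (s f) = series (s (fun x => `|f x| + f x)) - series (s (fun x => `|f x|)).
  apply/funext => n; rewrite fctE /series /= -sumrB; apply: eq_bigr => m _.
  have sub i : mu.-integrable (cell dx i) (EFin \o f) by exact: integrable_cell.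
  have nsub i : mu.-integrable (cell dx i) (EFin \o (fun x => `|f x|)).
    exact: integrable_cell.
  rewrite /s !RintegralD; first ring; by [exact: measurable_cell|].
have -> : \int[mu]_x f x = \int[mu]_x (`|f x| + f x) - \int[mu]_x `|f x|.
  by rewrite RintegralD// addrAC subrr add0r.
by apply: cvgB; apply: ge0_integrable_cells_cvg.
Qed.

End grid.

Section zsums.
Variable R : realType.

Lemma zsum_cvg (F : int -> R) : zsummable F ->
  series (fun n => F (Posz n) + F (Negz n)) @ \oo --> zsum F.
Proof.
move=> sF; apply: (@normed_cvg _ R^o).
by apply: series_le_cvg sF => n /=; rewrite ?ler_normD ?addr_ge0 ?normr_ge0.
Qed.

(** The first [N] pairs are the consecutive cells [- N, ..., N - 1], so only the two extreme nodes
    survive. *)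
Lemma telescope_zsum (G : int -> R) N :
  series (fun n => (G (Posz n + 1) - G (Posz n)) + (G (Negz n + 1) - G (Negz n))) N
  = G (Posz N) - G (- Posz N).
Proof.
elim: N => [|N IH]; first by rewrite /series /= big_geq// oppr0 subrr.
rewrite seriesSr /= IH.
have -> : Posz N + 1 = Posz N.+1 by lia.
have -> : Negz N + 1 = - Posz N by lia.
have -> : Negz N = - Posz N.+1 by lia.
ring.
Qed.

End zsums.

(** * The fractional seminorm *)

Section singular_integrals.
Variable R : realType.
Local Notation mu := (@lebesgue_measure R).

(** Continuity is required on [[a, b]] only, since the powers to be integrated are singular at a
    point outside. *)
Lemma integral_oo_FTC2 (f F : R -> R) (a b : R) : a < b ->
  measurable_fun setT f ->
  (forall x, x \in `[a, b] -> {for x, continuous f}) ->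
  (forall x, x \in `[a, b] -> is_derive x 1 F (f x)) ->
  (\int[mu]_(x in `]a, b[) (f x)%:E = (F b - F a)%:E)%E.
Proof.
move=> ab mf cf dF.
have cF x : x \in `[a, b] -> {for x, continuous F}.
  by move=> /dF dFx; apply: differentiable_continuous; apply/derivable1_diffP.
have aI : a \in `[a, b] by rewrite in_itv/= lexx ltW.
have bI : b \in `[a, b] by rewrite in_itv/= lexx ltW.
rewrite -(@integral_itv_bndoo _ a b _ true false); last first.
  by apply/measurable_EFinP; exact: measurable_funTS.
rewrite (@continuous_FTC2 _ f F)//.
- by apply: continuous_in_subspaceT => x; rewrite inE => /cf.
- split=> [x xab| |].
  + by have [] := dF x (subset_itv_oo_cc xab).
  + by apply: cvg_at_right_filter; exact: cF.
  + by apply: cvg_at_left_filter; exact: cF.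
- move=> x xab; rewrite derive1E.
  by have dFx := dF x (subset_itv_oo_cc xab); rewrite derive_val.
Qed.

(** Improper integrals are bounded by monotone convergence from intervals that avoid the singularity
    or infinity; upper bounds suffice throughout. *)
Lemma ge0_integral_exhaustion_le (f : R -> R) (F : nat -> set R) (M : \bar R) :
  (forall x, 0 <= f x) -> measurable_fun setT f ->
  (forall n m, (n <= m)%N -> F n `<=` F m) -> (forall n, measurable (F n)) ->
  (forall n, (\int[mu]_(x in F n) (f x)%:E <= M)%E) ->
  (\int[mu]_(x in \bigcup_n F n) (f x)%:E <= M)%E.
Proof.
move=> f0 mf ndF mF fM.
have cv : (fun n => \int[mu]_(x in F n) (f x)%:E)%E @ \oo
    --> (\int[mu]_(x in \bigcup_n F n) (f x)%:E)%E.
  apply: ge0_nondecreasing_set_cvg_integral => //.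
  - by move=> n m nm; apply/subsetPset; exact: ndF.
  - by move=> i; apply/measurable_EFinP; exact: measurable_funTS.
  - by move=> i x _; rewrite lee_fin.
rewrite -(cvg_lim _ cv)//; apply: lime_le; first by apply/cvg_ex; eexists; exact: cv.
exact: nearW.
Qed.

Lemma ge0_integral_reflect (A : set (measurableTypeR R)) (f : R -> R) : measurable A ->
  measurable_fun setT f -> (forall x, 0 <= f x) ->
  (\int[mu]_(x in A) (f x)%:E = \int[mu]_(x in -%R @^-1` A) (f (- x))%:E)%E.
Proof.
move=> mA mf f0.
have mopp : measurable_fun setT (-%R : measurableTypeR R -> measurableTypeR R).
  by [].
have mfA : measurable_fun A (EFin \o f : measurableTypeR R -> \bar R).
  by apply/measurable_EFinP; exact: measurable_funTS.
have fA0 : {in A, forall y, (0 <= (EFin \o f) y)%E}.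
  by move=> x _; rewrite lee_fin.
rewrite -(ge0_integral_pushforward mopp mu mA mfA fA0).
apply: eq_measure_integral => B mB _.
by rewrite -[LHS]lebesgue_measureN.
Qed.

Lemma is_derive_powR_shift (c x p : R) : c < x ->
  is_derive x 1 (fun y => (y - c) `^ p) (p * (x - c) `^ (p - 1)).
Proof.
move=> cx; have xc : 0 < x - c by rewrite subr_gt0.
have d1 : is_derive x 1 (fun y : R => y - c) 1.
  by apply: is_derive_eq; rewrite subr0.
rewrite -[X in is_derive _ _ _ X]mulr1.
have := @is_derive1_comp _ (@powR R ^~ p) (fun y : R => y - c) x _ _ (is_derive1_powR p xc) d1.
exact.
Qed.

Lemma is_derive_continuous (f : R -> R) (x d : R) :
  is_derive x 1 f d -> {for x, continuous f}.
Proof. by move=> ?; apply: differentiable_continuous; apply/derivable1_diffP. Qed.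

Lemma measurable_powR_shift (c p : R) :
  measurable_fun setT (fun y : R => (y - c) `^ p).
Proof.
apply: (measurableT_comp (measurable_powR p)).
by apply: measurable_funB.
Qed.

Lemma integral_powR_shift (c p a b : R) : c < a -> a < b -> p != - 1 ->
  (\int[mu]_(x in `]a, b[) ((x - c) `^ p)%:E
   = (((b - c) `^ (p + 1) - (a - c) `^ (p + 1)) / (p + 1))%:E)%E.
Proof.
move=> ca ab p1; have p10 : p + 1 != 0 by rewrite addr_eq0.
pose F x := (p + 1)^-1 * (x - c) `^ (p + 1).
have cf x : x \in `[a, b] -> {for x, continuous (fun y : R => (y - c) `^ p)}.
  move=> /[!in_itv]/= /andP[ax _]; apply: is_derive_continuous.
  by apply: is_derive_powR_shift; exact: lt_le_trans ax.
have dF x : x \in `[a, b] -> is_derive x 1 F ((x - c) `^ p).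
  move=> /[!in_itv]/= /andP[ax _]; have cx : c < x by exact: lt_le_trans ax.
  have := is_derive_powR_shift (p + 1) cx.
  rewrite addrK => /(@is_deriveZ _ _ _ _ (p + 1)^-1).
  by rewrite /GRing.scale/= mulKf.
rewrite (integral_oo_FTC2 ab (measurable_powR_shift c p) cf dF).
by congr EFin; rewrite /F mulrBl; congr (_ - _); rewrite mulrC.
Qed.

Lemma integral_powR_tail (c p b : R) : c < b -> p < - 1 ->
  (\int[mu]_(x in `]b, +oo[) ((x - c) `^ p)%:E
   <= ((b - c) `^ (p + 1) / - (p + 1))%:E)%E.
Proof.
move=> cb p1; have p10 : p + 1 < 0 by rewrite -ltrBrDr sub0r.
have -> : `]b, +oo[%classic = \bigcup_n `]b, b + n.+1%:R[%classic.
  apply/seteqP; split => [x /=|x [n _] /=]; rewrite !in_itv/= ?andbT.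
    move=> bx; exists (Num.trunc (x - b)) => //=; rewrite in_itv/= bx/=.
    by rewrite -ltrBlDl truncnS_gt.
  by move=> /andP[].
apply: ge0_integral_exhaustion_le.
- by move=> x; exact: powR_ge0.
- exact: measurable_powR_shift.
- move=> n m nm x /=; rewrite !in_itv/= => /andP[-> /=] /lt_le_trans; apply.
  by rewrite lerD2l ler_nat.
- by move=> n; exact: measurable_itv.
- move=> n; rewrite integral_powR_shift ?ltrDl ?ltr0n// ?lt_eqF//.
  by rewrite lee_fin invrN mulrN -mulNr ler_nM2r ?invr_lt0// lerDr powR_ge0.
Qed.

Lemma integral_powR_local (c p b : R) : c < b -> - 1 < p ->
  (\int[mu]_(x in `]c, b[) ((x - c) `^ p)%:E
   <= ((b - c) `^ (p + 1) / (p + 1))%:E)%E.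
Proof.
move=> cb p1; have p10 : 0 < p + 1 by rewrite -ltrBlDr sub0r.
have bc : 0 < b - c by rewrite subr_gt0.
(* With [n.+1] the left end would be [b] itself at [n = 0]; [n.+2] keeps every interval
   nondegenerate. *)
have -> : `]c, b[%classic = \bigcup_n `]c + (b - c) / n.+2%:R, b[%classic.
  apply/seteqP; split => [x /=|x [n _] /=]; rewrite !in_itv/=.
    move=> /andP[cx xb]; exists (Num.trunc ((b - c) / (x - c))) => //=.
    rewrite in_itv/= xb andbT -ltrBrDl ltr_pdivrMr ?ltr0n//.
    rewrite mulrC -ltr_pdivrMr ?subr_gt0//.
    by rewrite (lt_trans (truncnS_gt _))// ltr_nat.
  move=> /andP[cx ->]; rewrite andbT; apply: lt_trans cx.
  by rewrite ltrDl divr_gt0.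
apply: ge0_integral_exhaustion_le.
- by move=> x; exact: powR_ge0.
- exact: measurable_powR_shift.
- move=> n m nm x /=; rewrite !in_itv/= => /andP[h ->]; rewrite andbT.
  apply: le_lt_trans h; rewrite lerD2l ler_wpM2l ?(ltW bc)//.
  by rewrite lef_pV2 ?posrE ?ltr0n// ler_nat.
- by move=> n; exact: measurable_itv.
- move=> n; rewrite integral_powR_shift ?gt_eqF//.
  + rewrite lee_fin ler_wpM2r ?invr_ge0 ?(ltW p10)//.
    by rewrite lerBlDr lerDl powR_ge0.
  + by rewrite ltrDl divr_gt0.
  + by rewrite -ltrBrDl ltr_pdivrMr ?ltr0n// ltr_pMr// ltr1n.
Qed.

End singular_integrals.

Section gagliardo.
Variables (R : realType) (lam : R).
Hypothesis lam01 : 0 < lam < 1.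
Local Notation mu := (@lebesgue_measure R).
Local Notation mu2 := (mu \x mu)%E.

(* The weight is a real power rather than [(Num.sqrt _)^-1] so that it is
   measurable by [measurable_powR]; both vanish on the diagonal. *)
Definition gagliardo (u : R -> R) (p : measurableTypeR R * measurableTypeR R) : R :=
  (u p.2 - u p.1) * `|p.2 - p.1| `^ (- (1 + lam) / 2).

Lemma kernelV x z : (Defs.kernel lam x z)^-1 = `|z - x| `^ (- (1 + lam)).
Proof. by rewrite powRN. Qed.

Lemma kernelV_ge0 x z : 0 <= (Defs.kernel lam x z)^-1.
Proof. by rewrite kernelV powR_ge0. Qed.

Lemma kernelC x z : Defs.kernel lam x z = Defs.kernel lam z x.
Proof. by rewrite /Defs.kernel distrC. Qed.

Lemma gagliardoM u v p : gagliardo u p * gagliardo v p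
  = (u p.2 - u p.1) * (v p.2 - v p.1) / Defs.kernel lam p.1 p.2.
Proof.
rewrite /gagliardo mulrACA kernelV -powRD; first by congr (_ * _ `^ _); field.
(* Exponents may be added even at base 0 as long as their sum is nonzero; here it is
   [- (1 + lam) < 0]. *)
apply/implyP => /eqP h; exfalso; have /andP[l0 _] := lam01.
have : - (1 + lam) / 2 + - (1 + lam) / 2 = - (1 + lam) by field.
rewrite h => /eqP; lra.
Qed.

Lemma gagliardo_sqr u p : gagliardo u p ^+ 2
  = (u p.2 - u p.1) ^+ 2 / Defs.kernel lam p.1 p.2.
Proof. by rewrite expr2 gagliardoM. Qed.

(** This makes bilinearity and Cauchy-Schwarz available for the nonlocal form. *)
Lemma fracformE c u v :
  fracform c lam u v = - (c / 2) * ip mu2 (gagliardo u) (gagliardo v).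
Proof.
by congr (_ * _); apply: eq_Rintegral => p _; rewrite gagliardoM.
Qed.

Lemma measurable_dist_powR r : measurable_fun setT
  (fun p : measurableTypeR R * measurableTypeR R => `|p.2 - p.1| `^ r).
Proof.
apply: (measurableT_comp (measurable_powR r)).
apply: measurableT_comp => //.
by apply: measurable_funB; [exact: measurable_snd|exact: measurable_fst].
Qed.

Lemma measurable_gagliardo (u : R -> R) : measurable_fun setT u ->
  measurable_fun setT (gagliardo u).
Proof.
move=> mu'; apply: measurable_funM; last exact: measurable_dist_powR.
apply: measurable_funB.
  exact: (measurableT_comp mu' measurable_snd).
exact: (measurableT_comp mu' measurable_fst).
Qed.

Lemma Hsemi2E (u : R -> R) : measurable_fun setT u ->
  Hsemi2 lam u = (\int[mu2]_p ((gagliardo u p) ^+ 2)%:E)%E.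
Proof.
move=> mu'; rewrite fubini_tonelli1.
- by apply: eq_integral => x _; apply: eq_integral => z _; rewrite gagliardo_sqr.
- apply/measurable_EFinP; apply: measurable_funX; exact: measurable_gagliardo.
- by move=> p; rewrite lee_fin sqr_ge0.
Qed.

(** The bound blows up as [x] approaches [b], but only with exponent [- lam > - 1], so it can still
    be integrated over a cell ending at [b]. *)
Lemma kernel_tail_right (x b : R) : x < b ->
  (\int[mu]_(z in `[b, +oo[) ((Defs.kernel lam x z)^-1)%:E
   <= ((b - x) `^ (- lam) / lam)%:E)%E.
Proof.
move=> xb; have /andP[l0 l1] := lam01.
rewrite -integral_itv_obnd_cbnd; last first.
  apply/measurable_EFinP; apply: measurable_funTS.
  under eq_fun do rewrite kernelV.
  apply: (measurableT_comp (measurable_powR _)).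
  by apply: measurableT_comp => //; apply: measurable_funB.
have p1 : - (1 + lam) < - 1 by lra.
have := integral_powR_tail xb p1.
have -> : - (1 + lam) + 1 = - lam by ring.
rewrite opprK; apply: le_trans; rewrite le_eqVlt; apply/orP; left; apply/eqP.
apply: eq_integral => z; rewrite inE/= in_itv/= andbT => bz.
by rewrite kernelV ger0_norm// subr_ge0 (ltW (lt_trans xb bz)).
Qed.

Lemma measurable_kernelV (x : R) :
  measurable_fun setT (fun z : R => (Defs.kernel lam x z)^-1).
Proof.
under eq_fun do rewrite kernelV.
apply: (measurableT_comp (measurable_powR _)).
by apply: measurableT_comp => //; apply: measurable_funB.
Qed.

Lemma kernel_tail_left (x a : R) : a < x ->
  (\int[mu]_(z in `]-oo, a[) ((Defs.kernel lam x z)^-1)%:E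
   <= ((x - a) `^ (- lam) / lam)%:E)%E.
Proof.
move=> ax; rewrite (@ge0_integral_reflect _ _ (fun z => (Defs.kernel lam x z)^-1)).
- have -> : -%R @^-1` `]-oo, a[%classic = `](- a), +oo[%classic.
    by apply/seteqP; split=> z /=; rewrite !in_itv/= andbT ltrNl.
  rewrite integral_itv_obnd_cbnd; last first.
    apply/measurable_EFinP; apply: measurable_funTS.
    exact: (measurableT_comp (measurable_kernelV x)).
  have xa : - x < - a by rewrite ltrN2.
  have := kernel_tail_right xa; rewrite opprK (addrC (- a)).
  apply: le_trans; rewrite le_eqVlt; apply/orP; left; apply/eqP.
  by apply: eq_integral => z _; rewrite !kernelV opprK -opprD normrN.
- exact: measurable_itv.
- exact: measurable_kernelV.
- by move=> z; exact: kernelV_ge0.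
Qed.

Lemma powR_local_left (a b : R) : a < b ->
  (\int[mu]_(x in `]a, b[) ((x - a) `^ (- lam))%:E
   <= ((b - a) `^ (1 - lam) / (1 - lam))%:E)%E.
Proof.
move=> ab; have /andP[l0 l1] := lam01.
have p1 : - 1 < - lam by lra.
by have := integral_powR_local ab p1; rewrite (addrC (- lam)).
Qed.

Lemma powR_local_right (a b : R) : a < b ->
  (\int[mu]_(x in `]a, b[) ((b - x) `^ (- lam))%:E
   <= ((b - a) `^ (1 - lam) / (1 - lam))%:E)%E.
Proof.
move=> ab; rewrite (@ge0_integral_reflect _ _ (fun x => (b - x) `^ (- lam))).
- have -> : -%R @^-1` `]a, b[%classic = `](- b), (- a)[%classic.
    by apply/seteqP; split=> z /=; rewrite !in_itv/= ltrNl ltrNr andbC.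
  have ba : - b < - a by rewrite ltrN2.
  have := powR_local_left ba; rewrite opprK (addrC (- a)).
  apply: le_trans; rewrite le_eqVlt; apply/orP; left; apply/eqP.
  by apply: eq_integral => z _; rewrite !opprK addrC.
- exact: measurable_itv.
- apply: (measurableT_comp (measurable_powR _)).
  exact: measurable_funB.
- by move=> z; exact: powR_ge0.
Qed.

End gagliardo.

(** * Bounding the fractional seminorm by the L^2 norm on the grid *)

Section fractional_inverse_inequality.
Variables (R : realType) (lam dx : R) (k : nat).
Hypotheses (lam01 : 0 < lam < 1) (dx0 : 0 < dx).
Local Notation mu := (@lebesgue_measure R).
Local Notation mu2 := (mu \x mu)%E.

Definition cellN (P : int -> {poly R}) i : R :=
  \int[mu]_(x in cell dx i) ((P i).[x] ^+ 2).

Lemma cellN_ge0 P i : 0 <= cellN P i.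
Proof. by apply: Rintegral_ge0 => x _; rewrite sqr_ge0. Qed.

Lemma integral_cell_sqr P i :
  (\int[mu]_(x in cell dx i) ((pw dx P x) ^+ 2)%:E = (cellN P i)%:E)%E.
Proof.
rewrite /cellN /Rintegral fineK.
  by apply: eq_integral => x; rewrite inE => /(pw_cell dx0) ->.
apply: integrable_fin_num; first exact: measurable_itv.
apply: continuous_integrable_oo => x.
have -> : (fun x => (P i).[x] ^+ 2) = horner (P i ^+ 2).
  by apply/funext => y; rewrite horner_exp.
exact: continuous_horner.
Qed.

Lemma lebesgue_measure_cell i : (mu (cell dx i) = dx%:E)%E.
Proof.
rewrite cellE lebesgue_measure_itv/= lte_fin ltrDl dx0 -EFinD.
by rewrite addrAC subrr add0r.
Qed.

Lemma lebesgue_measure_hcell i : (mu (hcell dx i) = dx%:E)%E.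
Proof.
rewrite /hcell nodeS lebesgue_measure_itv/= lte_fin ltrDl dx0 -EFinD.
by rewrite addrAC subrr add0r.
Qed.

Lemma integral_mul_indic (A : set R) (f : R -> R) :
  (\int[mu]_x (f x * \1_A x)%:E = \int[mu]_(x in A) (f x)%:E)%E.
Proof.
rewrite [RHS]integral_mkcond; apply: eq_integral => x _.
by rewrite patchE indicE; case: (x \in A); rewrite ?mulr1 ?mulr0.
Qed.

Lemma kernel_tail_cell i x : cell dx i x ->
  (\int[mu]_(z in ~` hcell dx i) ((Defs.kernel lam x z)^-1)%:E
   <= (((x - node dx i) `^ (- lam) + (node dx i + dx - x) `^ (- lam)) / lam)%:E)%E.
Proof.
rewrite cellE /= in_itv/= => /andP[ax xb].
have -> : ~` hcell dx i = `]-oo, node dx i[ `|` `[node dx i + dx, +oo[.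
  apply/seteqP; split => z; rewrite /hcell nodeS /= !in_itv/= andbT.
    by move=> /negP; rewrite negb_and -!real_ltNge ?num_real// -real_leNgt ?num_real// => /orP.
  move=> zab /andP[az zb]; case: zab => [|]; first by rewrite ltNge az.
  by rewrite leNgt zb.
rewrite ge0_integral_setU//; first last.
- apply/eqP; rewrite -subset0 => z []/=; rewrite !in_itv/= andbT => h1 h2.
  by move: h1 h2 dx0; rewrite /set0/=; lra.
- by move=> z _; rewrite lee_fin kernelV_ge0.
- by apply/measurable_EFinP; apply: measurable_funTS; exact: measurable_kernelV.
rewrite mulrDl EFinD; apply: leeD.
  exact: kernel_tail_left.
exact: kernel_tail_right.
Qed.

Lemma kernel_tail_cell_total i :
  (\int[mu]_(x in cell dx i)
    (((x - node dx i) `^ (- lam) + (node dx i + dx - x) `^ (- lam)) / lam)%:E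
   <= (2 * dx `^ (1 - lam) / (1 - lam) / lam)%:E)%E.
Proof.
have /andP[l0 l1] := lam01.
have m1 : measurable_fun setT (fun x : R => (x - node dx i) `^ (- lam)).
  exact: measurable_powR_shift.
have m2 : measurable_fun setT (fun x : R => (node dx i + dx - x) `^ (- lam)).
  by apply: (measurableT_comp (measurable_powR _)); exact: measurable_funB.
have ii : node dx i < node dx i + dx by rewrite ltrDl.
under eq_integral do rewrite mulrDl EFinD.
rewrite ge0_integralD//; first last.
- apply/measurable_EFinP/measurable_funTS; exact: measurable_funM.
- by move=> x _; rewrite lee_fin divr_ge0 ?powR_ge0// ltW.
- apply/measurable_EFinP/measurable_funTS; exact: measurable_funM.
- by move=> x _; rewrite lee_fin divr_ge0 ?powR_ge0// ltW.
- exact: measurable_cell.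
under eq_integral do rewrite mulrC EFinM.
rewrite ge0_integralZl_EFin//; first last.
- by rewrite invr_ge0 ltW.
- by apply/measurable_EFinP/measurable_funTS.
- by move=> x _; rewrite lee_fin powR_ge0.
- exact: measurable_cell.
under [X in (_ + X)%E]eq_integral do rewrite mulrC EFinM.
rewrite ge0_integralZl_EFin//; first last.
- by rewrite invr_ge0 ltW.
- by apply/measurable_EFinP/measurable_funTS.
- by move=> x _; rewrite lee_fin powR_ge0.
- exact: measurable_cell.
have -> : 2 * dx `^ (1 - lam) / (1 - lam) / lam
  = lam^-1 * (dx `^ (1 - lam) / (1 - lam)) + lam^-1 * (dx `^ (1 - lam) / (1 - lam)).
  by ring.
rewrite cellE EFinD !EFinM; apply: leeD; apply: lee_wpmul2l;
  rewrite ?lee_fin ?invr_ge0 ?(ltW l0)// -EFinM.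
- have := powR_local_left lam01 ii.
  by rewrite addrAC subrr add0r.
- have := powR_local_right lam01 ii.
  by rewrite addrAC subrr add0r.
Qed.

(** The squared Lipschitz increment outweighs the kernel: the exponent [2 - (1 + lam)] is
    positive. *)
Lemma kernel_same_cell (x z : R) : `|z - x| <= dx ->
  (z - x) ^+ 2 / Defs.kernel lam x z <= dx `^ (1 - lam).
Proof.
move=> zx; have /andP[l0 l1] := lam01.
have [->|nzx] := eqVneq z x; first by rewrite subrr expr0n mul0r powR_ge0.
have nz0 : 0 < `|z - x| by rewrite normr_gt0 subr_eq0.
have -> : (z - x) ^+ 2 / Defs.kernel lam x z = `|z - x| `^ (1 - lam).
  rewrite kernelV -real_normK ?num_real// -powR_mulrn ?(ltW nz0)// -powRD.
    by congr (_ `^ _); ring.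
  by rewrite (gt_eqF nz0) implybT.
by rewrite ge0_ler_powR// ?nnegrE ?(ltW nz0) ?(ltW dx0)//; lra.
Qed.

Definition same_cell : set (measurableTypeR R * measurableTypeR R) :=
  [set p | Num.floor (p.1 / dx) = Num.floor (p.2 / dx)].

Lemma measurable_same_cell : measurable same_cell.
Proof.
have -> : same_cell = \bigcup_n (hcell dx (Posz n) `*` hcell dx (Posz n)
                            `|` hcell dx (Negz n) `*` hcell dx (Negz n)).
  apply/seteqP; split => [[x z] /= xz|[x z] [n _] [] [/= /(hcellP dx0) xn /(hcellP dx0) zn]].
  - have := erefl (Num.floor (x / dx)); case: {2}(Num.floor _) => n xn.
      by exists n => //; left; split; apply/(hcellP dx0) => //=; rewrite -xz.
    by exists n => //; right; split; apply/(hcellP dx0) => //=; rewrite -xz.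
  - by rewrite /same_cell/= xn zn.
  - by rewrite /same_cell/= xn zn.
apply: bigcupT_measurable => n.
by apply: measurableU; apply: measurableX; exact: measurable_hcell.
Qed.

Lemma mem_same_cell x z i : hcell dx i x ->
  ((x, z) \in same_cell) = (z \in hcell dx i).
Proof.
move=> /(hcellP dx0) xi; apply/idP/idP; rewrite !inE /same_cell/= xi.
  by move=> zi; apply/(hcellP dx0).
by move/(hcellP dx0) => ->.
Qed.

Lemma indic_same_cell x z i : hcell dx i x ->
  \1_same_cell (x, z) = \1_(hcell dx i) z :> R.
Proof. by move=> xi; rewrite !indicE (mem_same_cell z xi). Qed.

Lemma indic_diff_cell x z i : hcell dx i x ->
  \1_(~` same_cell) (x, z) = \1_(~` hcell dx i) z :> R.
Proof. by move=> xi; rewrite !indicE !in_setC (mem_same_cell z xi). Qed.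

Lemma L2sq_cells_le (F : R -> \bar R) (K : R) (P : int -> {poly R}) :
  0 <= K -> measurable_fun setT F -> (forall x, (0 <= F x)%E) ->
  (forall i, (\int[mu]_(x in cell dx i) F x <= (K * cellN P i)%:E)%E) ->
  (\int[mu]_x F x <= K%:E * L2sq (pw dx P))%E.
Proof.
move=> K0 mF F0 FK.
have mP : measurable_fun setT (fun x => ((pw dx P x) ^+ 2)%:E).
  by apply/measurable_EFinP; apply: measurable_funX; exact: measurable_pw.
have -> : (K%:E * L2sq (pw dx P) = \int[mu]_x (K%:E * ((pw dx P x) ^+ 2)%:E))%E.
  by rewrite ge0_integralZl_EFin// => x _; rewrite lee_fin sqr_ge0.
apply: (ge0_le_integral_cells dx0) => //.
- by apply: emeasurable_funM.
- by move=> x; rewrite mule_ge0// lee_fin sqr_ge0.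
- move=> i; rewrite ge0_integralZl_EFin//; first last.
  + exact: measurable_funTS.
  + by move=> x _; rewrite lee_fin sqr_ge0.
  + exact: measurable_cell.
  by rewrite integral_cell_sqr -EFinM.
Qed.

Lemma Hsemi2_le_L2sq : exists2 K : R, 0 <= K & forall P : int -> {poly R},
  inVk k P -> (Hsemi2 lam (pw dx P) <= K%:E * L2sq (pw dx P))%E.
Proof.
have /andP[l0 l1] := lam01.
have [C C0 HC] := inverse_inequality k dx0.
pose Th := 2 * dx `^ (1 - lam) / (1 - lam) / lam.
have Th0 : 0 <= Th.
  by rewrite !divr_ge0 ?mulr_ge0 ?powR_ge0 ?subr_ge0 ?(ltW l0) ?(ltW l1).
(* [K0] is the same-cell bound times the area [dx * dx] of a square of cells. In [K1], the 2 comes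
   from [(y - x)^2 <= 2 x^2 + 2 y^2], [C] from the sup bound, and [Th] from integrating the kernel
   tails over a cell. [K1] will count twice, for [Phi1] and its mirror image. *)
pose K0 := C * dx `^ (1 - lam) * dx * dx; pose K1 := 2 * C * Th.
have K00 : 0 <= K0 by rewrite !mulr_ge0 ?powR_ge0 ?(ltW dx0).
have K10 : 0 <= K1 by apply: mulr_ge0 Th0; rewrite mulr_ge0.
exists (K0 + (K1 + K1)); first by apply: addr_ge0 => //; exact: addr_ge0.
move=> P VP; set u := pw dx P.
have mu' : measurable_fun setT u by exact: measurable_pw.
have HN i : (forall x, hcell dx i x -> (P i).[x] ^+ 2 <= C * cellN P i) /\
    (forall x z, hcell dx i x -> hcell dx i z ->
      ((P i).[z] - (P i).[x]) ^+ 2 <= C * cellN P i * (z - x) ^+ 2).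
  have [h1 h2] := HC (node dx i) _ (VP i); rewrite /cellN cellE.
  have sub x : hcell dx i x -> node dx i <= x <= node dx i + dx.
    by rewrite /hcell nodeS/= in_itv/= => /andP[-> /ltW ->].
  by split=> [x /sub|x z /sub xi /sub]; [exact: h1|exact: h2].
pose c x := C * cellN P (Num.floor (x / dx)) * dx `^ (1 - lam).
have c0 x : 0 <= c x by apply: mulr_ge0 (powR_ge0 _ _); rewrite mulr_ge0 ?cellN_ge0.
have mc : measurable_fun setT c.
  by apply: (@measurable_cellwise _ _ dx0 _ _
    (fun i _ => C * cellN P i * dx `^ (1 - lam))) => i; exact: measurable_cst.
pose Phi0 (p : measurableTypeR R * measurableTypeR R) := c p.1 * \1_same_cell p.
pose Phi1 (p : measurableTypeR R * measurableTypeR R) :=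
  2 * u p.1 ^+ 2 * (Defs.kernel lam p.1 p.2)^-1 * \1_(~` same_cell) p.
have Phi0_ge0 p : 0 <= Phi0 p by rewrite mulr_ge0.
have Phi1_ge0 p : 0 <= Phi1 p.
  by apply: mulr_ge0 => //; apply: mulr_ge0 (kernelV_ge0 _ _ _); rewrite mulr_ge0 ?sqr_ge0.
have mPhi0 : measurable_fun setT Phi0.
  apply: measurable_funM; last exact: measurable_indic measurable_same_cell.
  exact: (measurableT_comp mc measurable_fst).
have mPhi1 : measurable_fun setT Phi1.
  apply: measurable_funM; last first.
    by apply: measurable_indic; apply: measurableC; exact: measurable_same_cell.
  apply: measurable_funM.
    apply: measurable_funM => //; apply: measurable_funX.
    exact: (measurableT_comp mu' measurable_fst).
  under eq_fun do rewrite kernelV.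
  exact: measurable_dist_powR.
have mPhi1s : measurable_fun setT (fun p => Phi1 (p.2, p.1)).
  exact: (measurableT_comp mPhi1 (measurable_fun_pair measurable_snd measurable_fst)).
(* Inside a cell the Lipschitz bound applies. Between different cells the squared difference is
   split into its two values: [Phi1] carries the one at [p.1], the mirrored [Phi1] the one at
   [p.2]. *)
have le_gag p : gagliardo lam u p ^+ 2 <= Phi0 p + (Phi1 p + Phi1 (p.2, p.1)).
  case: p => x z; rewrite (gagliardo_sqr lam01) /=.
  have [xz|xz] := pselect (same_cell (x, z)).
    have xi : hcell dx (Num.floor (x / dx)) x by apply/(hcellP dx0).
    have zi : hcell dx (Num.floor (x / dx)) z by apply/(hcellP dx0); rewrite xz.
    apply: ler_wpDr; first by rewrite addr_ge0.
    rewrite /Phi0 indicE mem_set// mulr1 /c /=.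
    have [_ h] := HN (Num.floor (x / dx)).
    rewrite /u (pw_hcell dx0 P xi) (pw_hcell dx0 P zi).
    apply: (@le_trans _ _ (C * cellN P (Num.floor (x / dx)) * (z - x) ^+ 2 / Defs.kernel lam x z)).
      by rewrite ler_wpM2r ?kernelV_ge0// h.
    rewrite -mulrA ler_wpM2l ?mulr_ge0 ?cellN_ge0//.
    apply: kernel_same_cell => //.
    move: xi zi; rewrite /hcell nodeS /= !in_itv/= => /andP[x1 x2] /andP[z1 z2].
    by rewrite ler_norml; apply/andP; split; lra.
  have xz' : ~ same_cell (z, x) by move=> h; apply: xz.
  rewrite ler_wpDl//.
  rewrite /Phi1 !indicE !mem_set// !mulr1 /= (kernelC lam z x) -mulrDl.
  apply: ler_wpM2r; first exact: kernelV_ge0.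
  by have := sqr_ge0 (u z + u x); nra.
have I0 : (\int[mu2]_p (Phi0 p)%:E <= K0%:E * L2sq u)%E.
  rewrite fubini_tonelli1//; [|exact/measurable_EFinP].
  have mF := measurable_fun_fubini_tonelli_F (EFin \o Phi0)
    ((measurable_EFinP _ _).2 mPhi0).
  apply: L2sq_cells_le => //; [exact: mF| |move=> i].
    by move=> y; apply: integral_ge0 => w _; rewrite lee_fin.
  rewrite (eq_integral (fun=> (C * cellN P i * dx `^ (1 - lam) * dx)%:E)); last first.
    move=> x; rewrite inE => /cell_hcell xi; rewrite /fubini_F /=.
    under eq_integral do rewrite /Phi0 /= (indic_same_cell _ xi).
    rewrite (integral_mul_indic _ (fun=> c x)) integral_cst; last exact: measurable_hcell.
    rewrite [X in (_ * X)%E]lebesgue_measure_hcell.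
    by rewrite /c; move/(hcellP dx0) : xi => ->; rewrite -EFinM.
  rewrite integral_cst; last exact: measurable_cell.
  rewrite [X in (_ * X)%E]lebesgue_measure_cell.
  by rewrite -EFinM lee_fin /K0 le_eqVlt; apply/orP; left; apply/eqP; ring.
have I1 : (\int[mu2]_p (Phi1 p)%:E <= K1%:E * L2sq u)%E.
  rewrite fubini_tonelli1//; [|exact/measurable_EFinP].
  have mF := measurable_fun_fubini_tonelli_F (EFin \o Phi1)
    ((measurable_EFinP _ _).2 mPhi1).
  apply: L2sq_cells_le => //; [exact: mF| |move=> i].
    by move=> y; apply: integral_ge0 => w _; rewrite lee_fin.
  pose t x := ((x - node dx i) `^ (- lam) + (node dx i + dx - x) `^ (- lam)) / lam.
  have t0 x : 0 <= t x by rewrite divr_ge0 ?addr_ge0 ?powR_ge0// ltW.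
  have mt : measurable_fun setT t.
    apply: measurable_funM => //; apply: measurable_funD.
      exact: measurable_powR_shift.
    by apply: (measurableT_comp (measurable_powR _)); exact: measurable_funB.
  apply: (@le_trans _ _ (\int[mu]_(x in cell dx i) ((2 * C * cellN P i)%:E * (t x)%:E))%E).
    apply: ge0_le_integral.
    - exact: measurable_cell.
    - by move=> x _; apply: integral_ge0 => z _; rewrite lee_fin.
    - by apply: measurable_funTS; exact: mF.
    - by apply: measurable_funeM; apply/measurable_EFinP; exact: measurable_funTS.
    - move=> x xi; have xh := cell_hcell xi; rewrite /fubini_F /=.
      under eq_integral do rewrite /Phi1 /= (indic_diff_cell _ xh).
      rewrite (integral_mul_indic _ (fun z => 2 * u x ^+ 2 * (Defs.kernel lam x z)^-1)).
      under eq_integral do rewrite EFinM.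
      rewrite ge0_integralZl_EFin; first last.
      + by rewrite mulr_ge0 ?sqr_ge0.
      + by apply/measurable_EFinP/measurable_funTS; exact: measurable_kernelV.
      + by move=> z _; rewrite lee_fin kernelV_ge0.
      + by apply: measurableC; exact: measurable_hcell.
      apply: lee_pmul.
      + by rewrite lee_fin mulr_ge0 ?sqr_ge0.
      + by apply: integral_ge0 => z _; rewrite lee_fin kernelV_ge0.
      + rewrite lee_fin -mulrA ler_wpM2l// /u (pw_hcell dx0 P xh).
        by have [h _] := HN i; exact: h.
      + exact: kernel_tail_cell.
  rewrite ge0_integralZl_EFin; first last.
  - by rewrite !mulr_ge0 ?cellN_ge0.
  - by apply/measurable_EFinP; exact: measurable_funTS.
  - by move=> x _; rewrite lee_fin.
  - exact: measurable_cell.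
  apply: (@le_trans _ _ ((2 * C * cellN P i)%:E * Th%:E)%E).
    apply: lee_wpmul2l; first by rewrite lee_fin !mulr_ge0 ?cellN_ge0.
    exact: kernel_tail_cell_total.
  by rewrite -EFinM lee_fin /K1 le_eqVlt; apply/orP; left; apply/eqP; ring.
(* Tonelli in the two orders: the mirrored part costs nothing new. *)
have I1s : (\int[mu2]_p (Phi1 (p.2, p.1))%:E = \int[mu2]_p (Phi1 p)%:E)%E.
  have m1 := (measurable_EFinP _ _).2 mPhi1s.
  have m2 := (measurable_EFinP _ _).2 mPhi1.
  have e1 := fubini_tonelli1 (m1 := mu) (m2 := mu) _ m1.
  have e2 := fubini_tonelli2 (m1 := mu) (m2 := mu) _ m2.
  etransitivity; first by apply: e1 => p; rewrite /= lee_fin.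
  by apply/esym; apply: e2 => p; rewrite /= lee_fin.
rewrite Hsemi2E//.
apply: (@le_trans _ _ (\int[mu2]_p ((Phi0 p)%:E + ((Phi1 p)%:E + (Phi1 (p.2, p.1))%:E)))%E).
  apply: ge0_le_integral => //.
  - by move=> p _; rewrite lee_fin sqr_ge0.
  - by apply/measurable_EFinP/measurable_funX; exact: measurable_gagliardo.
  - by apply: emeasurable_funD; [|apply: emeasurable_funD]; exact/measurable_EFinP.
  - by move=> p _; rewrite -!EFinD lee_fin.
rewrite ge0_integralD//; first last.
- by apply: emeasurable_funD; exact/measurable_EFinP.
- by move=> p _; rewrite -EFinD lee_fin addr_ge0.
- exact/measurable_EFinP.
- by move=> p _; rewrite lee_fin.
rewrite ge0_integralD//; first last.
- exact/measurable_EFinP.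
- by move=> p _; rewrite lee_fin.
- exact/measurable_EFinP.
- by move=> p _; rewrite lee_fin.
have L0 : (0 <= L2sq u)%E by apply: integral_ge0 => x _; rewrite lee_fin sqr_ge0.
rewrite I1s !EFinD !ge0_muleDl ?lee_fin// ?addr_ge0//.
by apply: leeD => //; exact: leeD.
Qed.

End fractional_inverse_inequality.

(** * Truncation to finitely many cells *)

Section cell_truncation.
Variables (R : realType) (lam dx : R) (k : nat).
Hypotheses (lam01 : 0 < lam < 1) (dx0 : 0 < dx).
Local Notation mu := (@lebesgue_measure R).
Local Notation mu2 := (mu \x mu)%E.
Implicit Types (P Q : int -> {poly R}) (s : seq int).

Definition L2pw P := sqint mu (pw dx P).

Lemma L2pwP P : (L2sq (pw dx P) < +oo)%E -> L2pw P.
Proof. by move=> h; split => //; exact: measurable_pw. Qed.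

Lemma L2sqE P : L2pw P -> L2sq (pw dx P) = (ip mu (pw dx P) (pw dx P))%:E.
Proof. exact: ipE. Qed.

Lemma gagliardoD u v p :
  gagliardo lam (fun x => u x + v x) p = gagliardo lam u p + gagliardo lam v p.
Proof. by rewrite /gagliardo; ring. Qed.

Lemma gagliardoB u v p :
  gagliardo lam (fun x => u x - v x) p = gagliardo lam u p - gagliardo lam v p.
Proof. by rewrite /gagliardo; ring. Qed.

Lemma sqint_gagliardo P : inVk k P -> L2pw P ->
  sqint mu2 (gagliardo lam (pw dx P)).
Proof.
move=> VP sP; have mP := measurable_pw dx0 P.
split; first exact: measurable_gagliardo.
have [K K0 /(_ P VP)] := Hsemi2_le_L2sq k lam01 dx0.
rewrite (Hsemi2E lam01)// => /le_lt_trans; apply.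
by rewrite lte_mul_pinfty// ?lee_fin// L2sqE// ltry.
Qed.

Lemma ip_gagliardo_le : exists2 K : R, 0 <= K & forall P, inVk k P -> L2pw P ->
  ip mu2 (gagliardo lam (pw dx P)) (gagliardo lam (pw dx P))
  <= K * ip mu (pw dx P) (pw dx P).
Proof.
have [K K0 HK] := Hsemi2_le_L2sq k lam01 dx0; exists K => // P VP sP.
have := HK P VP; rewrite (Hsemi2E lam01); last exact: measurable_pw.
by rewrite ipE; [rewrite L2sqE// -EFinM lee_fin|exact: sqint_gagliardo].
Qed.

(** A sharp cutoff stays in [V^k], because jumps at nodes are allowed, and is the sum of the
    cellwise test functions of the scheme. *)
Definition truncate s P (i : int) : {poly R} := if i \in s then P i else 0.

Lemma inVk_truncate s P : inVk k P -> inVk k (truncate s P).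
Proof. by move=> VP i; rewrite /truncate; case: ifP => _; rewrite ?VP ?size_poly0. Qed.

Lemma pw_truncate_nil P : pw dx (truncate [::] P) = fun=> 0.
Proof. by apply/funext => x; rewrite /pw /truncate horner0. Qed.

Lemma pw_truncate_cons i s P : i \notin s -> pw dx (truncate (i :: s) P) =
  fun x => pw dx (truncate [:: i] P) x + pw dx (truncate s P) x.
Proof.
move=> is'; apply/funext => x; rewrite /pw /truncate !inE.
case: eqVneq => [->|_] /=; last by rewrite horner0 add0r.
by rewrite (negbTE is') horner0 addr0.
Qed.

Lemma pw_truncate1 i P x :
  pw dx (truncate [:: i] P) x = (P i).[x] * \1_(hcell dx i) x.
Proof.
rewrite /pw /truncate inE indicE.
case: eqVneq => [xi|/eqP xi].
  by rewrite mem_set ?mulr1 ?xi//; apply/(hcellP dx0).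
by rewrite memNset ?mulr0 ?horner0// => /(hcellP dx0).
Qed.

Lemma indic_sqr (A : set R) x : (\1_A x : R) ^+ 2 = \1_A x.
Proof. by rewrite indicE; case: (x \in A); rewrite ?expr1n ?expr0n. Qed.

Lemma L2pw_truncate s P : uniq s -> L2pw (truncate s P).
Proof.
elim: s => [_|i s IH /= /andP[is' us]].
  rewrite /L2pw pw_truncate_nil; split; first exact: measurable_cst.
  by under eq_integral do rewrite expr0n/=; rewrite integral0 ltry.
rewrite /L2pw pw_truncate_cons//; apply: sqintD; last exact: IH.
split; first exact: measurable_pw.
under eq_integral do rewrite pw_truncate1 exprMn indic_sqr.
rewrite (integral_mul_indic _ (fun x => (P i).[x] ^+ 2)).
have cP : continuous (fun x : R => (P i).[x] ^+ 2).
  have -> : (fun x => (P i).[x] ^+ 2) = horner (P i ^+ 2).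
    by apply/funext => y; rewrite horner_exp.
  exact: continuous_horner.
rewrite (@integral_hcell R dx i (fun x => ((P i).[x] ^+ 2)%:E)); last first.
  by apply/measurable_EFinP; exact: continuous_measurable_fun.
have /integrableP[_] := continuous_integrable_oo (node dx i) (node dx (i + 1)) cP.
by under eq_integral do rewrite /= ger0_norm ?sqr_ge0//.
Qed.

Lemma ip_truncate1 Q P i :
  ip mu (pw dx Q) (pw dx (truncate [:: i] P))
  = \int[mu]_(x in cell dx i) ((Q i).[x] * (P i).[x]).
Proof.
rewrite /ip /Rintegral; congr fine.
under eq_integral do rewrite pw_truncate1 mulrA.
rewrite (integral_mul_indic _ (fun x => pw dx Q x * (P i).[x])).
rewrite (@integral_hcell R dx i (fun x => (pw dx Q x * (P i).[x])%:E)); last first.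
  apply/measurable_EFinP; apply: measurable_funM; first exact: measurable_pw.
  by apply: continuous_measurable_fun; exact: continuous_horner.
by apply: eq_integral => x; rewrite inE => /(pw_cell dx0) ->.
Qed.

Lemma ip_truncate Q P s : uniq s -> L2pw Q ->
  ip mu (pw dx Q) (pw dx (truncate s P))
  = \sum_(i <- s) \int[mu]_(x in cell dx i) ((Q i).[x] * (P i).[x]).
Proof.
move=> + sQ; elim: s => [_|i s IH /= /andP[is' us]].
  rewrite big_nil pw_truncate_nil /ip; under eq_Rintegral do rewrite mulr0.
  by rewrite /Rintegral integral0.
rewrite big_cons pw_truncate_cons// ipC ipDl//; first last.
- exact: L2pw_truncate.
- exact: L2pw_truncate.
by rewrite ipC ip_truncate1 ipC IH.
Qed.

Lemma truncate_idem s P x :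
  pw dx (truncate s P) x * pw dx (truncate s P) x = pw dx P x * pw dx (truncate s P) x.
Proof. by rewrite /pw /truncate; case: ifP => // _; rewrite horner0 !mulr0. Qed.

Lemma ip_truncate_self P s : uniq s ->
  ip mu (pw dx (truncate s P)) (pw dx (truncate s P)) = \sum_(i <- s) cellN dx P i.
Proof.
move=> us; rewrite (ip_truncate P us (L2pw_truncate P us)).
apply: eq_big_seq => i is'; apply: eq_Rintegral => x _.
by rewrite /truncate is' expr2.
Qed.

Lemma measurable_cellfun i (q : {poly R}) : measurable_fun setT (cellfun dx i q).
Proof.
have -> : cellfun dx i q = fun x => q.[x] * \1_(cell dx i) x.
  apply/funext => x; rewrite /cellfun indicE.
  by case: (x \in cell dx i); rewrite ?mulr1 ?mulr0.
apply: measurable_funM.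
  by apply: continuous_measurable_fun; exact: continuous_horner.
by apply: measurable_indic; exact: measurable_cell.
Qed.

Lemma cellfun_truncate P i x : x != node dx i ->
  cellfun dx i (P i) x = pw dx (truncate [:: i] P) x.
Proof.
move=> xi; rewrite pw_truncate1 /cellfun indicE.
have -> : (x \in cell dx i) = (x \in hcell dx i).
  apply/idP/idP; rewrite !inE; first exact: cell_hcell.
  rewrite /hcell /cell /= !in_itv/= => /andP[h ->].
  by rewrite andbT lt_neqAle h andbT eq_sym.
by case: (x \in _); rewrite ?mulr1 ?mulr0.
Qed.

(** [cellfun] is 0 at the left node of its cell, where the truncated [pw] takes the polynomial
    value. The pairs of points affected lie on two lines of the plane, a null set. *)
Lemma mu2_node_negligible (y : R) :
  {ae mu2, forall p, p.1 != y /\ p.2 != y}.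
Proof.
have m1 : measurable ([set y] `*` setT : set (measurableTypeR R * measurableTypeR R)).
  exact: measurableX.
have m2 : measurable (setT `*` [set y] : set (measurableTypeR R * measurableTypeR R)).
  exact: measurableX.
have n1 : mu2.-negligible ([set y] `*` setT).
  apply/negligibleP => //.
  by apply: etrans (product_measure1E _ _ _ _) _ => //; rewrite [X in (X * _)%E]lebesgue_measure_set1 mul0e.
have n2 : mu2.-negligible (setT `*` [set y]).
  apply/negligibleP => //.
  by apply: etrans (product_measure1E _ _ _ _) _ => //; rewrite [X in (_ * X)%E]lebesgue_measure_set1 mule0.
apply: negligibleS (negligibleU n1 n2) => -[x z] /= /not_andP[] /negP.
- by rewrite negbK => /eqP ->; left.
- by rewrite negbK => /eqP ->; right.
Qed.

Lemma fracform_cellfun c P i u : measurable_fun setT u ->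
  fracform c lam (cellfun dx i (P i)) u
  = fracform c lam (pw dx (truncate [:: i] P)) u.
Proof.
move=> mu'; rewrite !(fracformE lam01); congr (_ * _).
rewrite /ip /Rintegral; congr fine.
have mM v : measurable_fun setT v ->
    measurable_fun setT (EFin \o (fun p => gagliardo lam v p * gagliardo lam u p)).
  by move=> mv; apply/measurable_EFinP; apply: measurable_funM;
    exact: measurable_gagliardo.
apply: ae_eq_integral => //.
- by apply: mM; exact: measurable_cellfun.
- by apply: mM; exact: measurable_pw.
have [N [mN N0 sub]] := mu2_node_negligible (node dx i).
exists N; split => // p /= np; apply: sub => -[/= p1 p2]; apply: np => _.
by rewrite /gagliardo !cellfun_truncate.
Qed.

Lemma fracform_truncate c P s Q : uniq s -> inVk k P -> inVk k Q -> L2pw Q ->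
  \sum_(i <- s) fracform c lam (cellfun dx i (P i)) (pw dx Q)
  = fracform c lam (pw dx (truncate s P)) (pw dx Q).
Proof.
move=> + VP VQ sQ; elim: s => [_|i s IH /= /andP[is' us]].
  rewrite big_nil (fracformE lam01) pw_truncate_nil /ip.
  under eq_Rintegral do rewrite /gagliardo subrr !mul0r.
  by rewrite /Rintegral integral0 mulr0.
rewrite big_cons IH// fracform_cellfun; last exact: measurable_pw.
rewrite !(fracformE lam01) -mulrDr (pw_truncate_cons P is'); congr (_ * _).
have g1 : sqint mu2 (gagliardo lam (pw dx (truncate [:: i] P))).
  by apply: sqint_gagliardo; [exact: inVk_truncate|exact: L2pw_truncate].
have g2 : sqint mu2 (gagliardo lam (pw dx (truncate s P))).
  by apply: sqint_gagliardo; [exact: inVk_truncate|exact: L2pw_truncate].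
rewrite -(ipDl g1 g2 (sqint_gagliardo VQ sQ)).
by rewrite /ip; apply: eq_Rintegral => p _; rewrite gagliardoD.
Qed.

End cell_truncation.

(** * Monotone numerical fluxes *)

Section flux_primitive.
Variable R : realType.
Local Notation mu := (@lebesgue_measure R).

Lemma lipschitz_continuous (f : R -> R) (L : R) :
  (forall x y, `|f x - f y| <= L * `|x - y|) -> continuous f.
Proof.
move=> fL x; apply/cvgrPdist_lt => e e0.
have L1 : 0 < `|L| + 1 by rewrite ltr_wpDl.
near=> y.
rewrite (le_lt_trans (fL x y))//.
apply: (@le_lt_trans _ _ ((`|L| + 1) * `|x - y|)).
  by rewrite ler_wpM2r// ler_wpDr// ler_norm.
rewrite mulrC -ltr_pdivlMr//.
near: y; apply/nbhs_ballP; exists (e / (`|L| + 1)) => //=.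
exact: divr_gt0.
Unshelve. all: by end_near. Qed.

(** A primitive on a bounded range is enough, since at a fixed time the solution is bounded;
    integrating from [- M] treats both signs of [x] at once. *)
Lemma continuous_primitive (f : R -> R) (M : R) : continuous f ->
  exists F : R -> R, F 0 = 0 /\
    forall x : R, `|x| < M -> is_derive x 1 F (f x).
Proof.
move=> cf.
exists (fun x => \int[mu]_(s in `[- M, x]) f s - \int[mu]_(s in `[- M, 0]) f s).
split; first by rewrite subrr.
move=> x; rewrite ltr_norml => /andP[Mx xM].
have fi : mu.-integrable `[- M, M] (EFin \o f).
  apply: continuous_compact_integrable; first exact: segment_compact.
  by apply: continuous_subspaceT => y; exact: cf.
have [dF F'] := continuous_FTC1_closed xM fi Mx (cf x).
rewrite -[X in is_derive _ _ _ X]subr0.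
apply: is_deriveB.
by split; [exact: dF|rewrite -derive1E].
Qed.

Variables (f F : R -> R) (M L : R).
Hypotheses (fL : forall x y, `|f x - f y| <= L * `|x - y|) (f0 : f 0 = 0).
Hypotheses (F0 : F 0 = 0) (dF : forall x : R, `|x| < M -> is_derive x 1 F (f x)).

Let F_within (a b : R) : `|a| < M -> `|b| < M -> {within `[a, b], continuous F}.
Proof.
move=> aM bM; apply: continuous_in_subspaceT => x; rewrite inE/= in_itv/=.
move: aM bM; rewrite !ltr_norml => /andP[a1 a2] /andP[b1 b2] /andP[ax xb].
have xM : `|x| < M by rewrite ltr_norml; apply/andP; split; lra.
exact: is_derive_continuous (dF xM).
Qed.

Let F_MVT (a b : R) : `|a| < M -> `|b| < M -> a < b ->
  exists2 c, c \in `]a, b[ & F b - F a = f c * (b - a).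
Proof.
move=> aM bM ab; apply: MVT => //; last exact: F_within.
move=> x /[!in_itv]/= /andP[ax xb]; apply: dF.
move: aM bM; rewrite !ltr_norml => /andP[a1 a2] /andP[b1 b2].
by apply/andP; split; lra.
Qed.

(** Both [F] and [F' = f] vanish at 0 and [|f c| <= L |c|]. This makes the entropy part of a
    boundary term as small as the squared trace. *)
Lemma primitive_quadratic (x : R) : `|x| < M -> `|F x| <= L * x ^+ 2.
Proof.
move=> xM; have M0 : `|0 : R| < M by rewrite normr0 (le_lt_trans _ xM).
have fle c : `|f c| <= L * `|c| by have := fL c 0; rewrite f0 !subr0.
have L0 : 0 <= L by have := le_trans (normr_ge0 _) (fle 1); rewrite normr1 mulr1.
have [x0|x0|->] := ltgtP x 0; last by rewrite F0 normr0 expr0n mulr0.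
- have [c /[!in_itv]/= /andP[xc c0]] := F_MVT xM M0 x0.
  rewrite F0 !sub0r mulrN => /oppr_inj ->; rewrite normrM.
  apply: (@le_trans _ _ (L * `|c| * `|x|)); first by rewrite ler_wpM2r.
  by rewrite -mulrA ler_wpM2l// !ltr0_norm// expr2; nra.
- have [c /[!in_itv]/= /andP[c0 cx]] := F_MVT M0 xM x0.
  rewrite F0 !subr0 => ->; rewrite normrM.
  apply: (@le_trans _ _ (L * `|c| * `|x|)); first by rewrite ler_wpM2r.
  by rewrite -mulrA ler_wpM2l// !gtr0_norm// expr2; nra.
Qed.

(** By the mean value theorem the right side is [f c * (p - m)] with [c] strictly between the
    traces. Monotonicity in both arguments compares [fhat m p] with [fhat c c = f c], in the
    direction given by the sign of [p - m]: the flux is an E-flux. *)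
Lemma monotone_flux_le (fhat : R -> R -> R) (m p : R) :
  (forall u, fhat u u = f u) ->
  (forall x x' y, x <= x' -> fhat x y <= fhat x' y) ->
  (forall x y y', y <= y' -> fhat x y' <= fhat x y) ->
  `|m| < M -> `|p| < M -> fhat m p * (p - m) <= F p - F m.
Proof.
move=> fc f1 f2 mM pM; have [mp|pm|->] := ltgtP m p; last by rewrite !subrr mulr0.
- have [c /[!in_itv]/= /andP[mc cp] ->] := F_MVT mM pM mp.
  apply: ler_wpM2r; first by rewrite subr_ge0 ltW.
  rewrite -fc (le_trans (f2 _ _ _ (ltW cp)))//; exact: f1 (ltW mc).
- have [c /[!in_itv]/= /andP[pc cm]] := F_MVT pM mM pm.
  move=> h; have -> : F p - F m = f c * (p - m) by rewrite -opprB h; ring.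
  apply: ler_wnM2r; first by rewrite subr_le0 ltW.
  rewrite -fc (le_trans (f1 _ _ _ (ltW cm)))//; exact: f2 (ltW pc).
Qed.

Lemma Rintegral_flux (P : {poly R}) (a b : R) : a < b ->
  (forall x, a <= x <= b -> `|P.[x]| < M) ->
  \int[mu]_(x in `]a, b[) (f P.[x] * P^`().[x]) = F P.[b] - F P.[a].
Proof.
move=> ab PM; have cf := lipschitz_continuous fL.
apply: (@Rintegral_oo_FTC2 _ _ (F \o horner P)) => //.
  move=> x; apply: continuousM; last exact: continuous_horner.
  by apply: continuous_comp; [exact: continuous_horner|exact: cf].
move=> x /[!in_itv]/= xab.
exact: is_derive1_comp (dF (PM x xab)) (is_derive_poly P x).
Qed.

End flux_primitive.

(** Otherwise [1 / (n + 1) < w n / e] from [N0] on, and the harmonic series would converge. *)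
Lemma summable_harmonic_small (R : realType) (w : nat -> R) (e : R) (N0 : nat) :
  (forall n, 0 <= w n) -> cvgn (series w) -> 0 < e ->
  exists n, (N0 <= n)%N /\ n.+1%:R * w n <= e.
Proof.
move=> w0 cw e0; apply: contrapT => /forallNP H.
have Hw n : (N0 <= n)%N -> e < n.+1%:R * w n.
  by move=> n0; rewrite ltNge; apply/negP => h; apply: (H n).
apply: (@dvg_harmonic R).
(* Equal to 1 before [N0], it dominates the harmonic terms there, so that the comparison holds at
   every index. *)
pose u (n : nat) : R := (n < N0)%:R.
have cu : cvgn (series u).
  rewrite -(is_cvg_series_restrict N0).
  rewrite (_ : (fun n => _) = cst 0); first exact: is_cvg_cst.
  apply/funext => n; rewrite big_nat big1// => i /andP[i0 _].
  by rewrite /u ltnNge i0.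
have cv : cvgn (series (u + e^-1 *: w)).
  by apply: is_cvg_seriesD => //; exact: is_cvg_seriesZ.
have vE n : (u + e^-1 *: w) n = u n + e^-1 * w n by [].
have v0 n : 0 <= (u + e^-1 *: w) n.
  by rewrite vE addr_ge0 ?ler0n// mulr_ge0 ?invr_ge0 ?(ltW e0).
apply: series_le_cvg v0 _ cv => n; first exact: harmonic_ge0.
rewrite vE /u /=; have [nN|nN] := ltnP n N0.
  apply: ler_wpDr; first by rewrite mulr_ge0 ?invr_ge0 ?(ltW e0).
  by rewrite invf_le1 ?ltr0n// ler1n.
rewrite add0r mulrC ler_pdivlMr// mulrC ler_pdivrMr ?ltr0n//.
by rewrite mulrC ltW// Hw.
Qed.

(** * Windows of consecutive cells *)

Section cell_windows.
Variables (R : realType).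

(** The two one-sided windows both end at node 0, so the fluxes at [N] and at [- N] can each be
    compared with the flux there. *)
Definition posw N : seq int := [seq Posz n | n <- iota 0 N].
Definition negw N : seq int := [seq Negz n | n <- iota 0 N].
Definition window N := posw N ++ negw N.

Lemma uniq_posw N : uniq (posw N).
Proof. by rewrite map_inj_uniq ?iota_uniq// => i j []. Qed.

Lemma uniq_negw N : uniq (negw N).
Proof. by rewrite map_inj_uniq ?iota_uniq// => i j []. Qed.

Lemma uniq_window N : uniq (window N).
Proof.
rewrite cat_uniq uniq_posw uniq_negw andbT /=.
by apply/hasPn => _ /mapP[i _ ->]; apply/negP => /mapP[].
Qed.

Lemma big_posw (F : int -> R) N :
  \sum_(i <- posw N) F i = series (fun n => F (Posz n)) N.
Proof. by rewrite big_map /series /= /index_iota subn0. Qed.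

Lemma big_negw (F : int -> R) N :
  \sum_(i <- negw N) F i = series (fun n => F (Negz n)) N.
Proof. by rewrite big_map /series /= /index_iota subn0. Qed.

Lemma big_window (F : int -> R) N :
  \sum_(i <- window N) F i = series (fun n => F (Posz n) + F (Negz n)) N.
Proof. by rewrite big_cat /= big_posw big_negw /series /= big_split. Qed.

Lemma telescope_posw (G : int -> R) N :
  \sum_(i <- posw N) (G (i + 1) - G i) = G (Posz N) - G 0.
Proof.
rewrite big_posw; elim: N => [|N IH]; first by rewrite /series /= big_geq// subrr.
rewrite seriesSr IH; have -> : Posz N + 1 = Posz N.+1 by lia.
ring.
Qed.

Lemma telescope_negw (G : int -> R) N :
  \sum_(i <- negw N) (G (i + 1) - G i) = G 0 - G (- Posz N).
Proof.
rewrite big_negw; elim: N => [|N IH]; first by rewrite /series /= big_geq// oppr0 subrr.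
rewrite seriesSr IH; have -> : Negz N + 1 = - Posz N by lia.
have -> : Negz N = - Posz N.+1 by lia.
ring.
Qed.

End cell_windows.

(** * Convergence over growing windows *)

Section window_limits.
Variables (R : realType) (lam dx c : R) (k : nat).
Hypotheses (lam01 : 0 < lam < 1) (dx0 : 0 < dx).
Local Notation mu := (@lebesgue_measure R).
Local Notation mu2 := (mu \x mu)%E.
Variable P : int -> {poly R}.
Hypotheses (VP : inVk k P) (sP : L2pw dx P).
Local Notation u := (pw dx P).

Lemma cellN_cvg :
  series (fun n => cellN dx P (Posz n) + cellN dx P (Negz n)) @ \oo --> ip mu u u.
Proof.
have := integrable_cells_cvg dx0 (sqint_integrableM sP sP).
set s := series _; set s' := series _; suff -> : s = s' by [].
apply/funext => n; apply: eq_bigr => i _; congr (_ + _);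
by apply: eq_Rintegral => x; rewrite inE => /(pw_cell dx0) ->; rewrite expr2.
Qed.

Lemma ip_cells_cvg (Q : int -> {poly R}) : L2pw dx Q ->
  series (fun n => \int[mu]_(x in cell dx (Posz n)) ((Q (Posz n)).[x] * (P (Posz n)).[x])
    + \int[mu]_(x in cell dx (Negz n)) ((Q (Negz n)).[x] * (P (Negz n)).[x])) @ \oo
  --> ip mu (pw dx Q) u.
Proof.
move=> sQ; have := integrable_cells_cvg dx0 (sqint_integrableM sQ sP).
set s := series _; set s' := series _; suff -> : s = s' by [].
apply/funext => n; apply: eq_bigr => i _; congr (_ + _);
by apply: eq_Rintegral => x; rewrite inE => xi; rewrite !(pw_cell dx0 _ xi).
Qed.

(** Truncation is an orthogonal projection, so the squared norm of the remainder is the difference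
    of the squared norms. *)
Lemma truncate_window_cvg :
  (fun N => ip mu (fun x => u x - pw dx (truncate (window N) P) x)
               (fun x => u x - pw dx (truncate (window N) P) x)) @ \oo --> (0 : R).
Proof.
have -> : (fun N => ip mu (fun x => u x - pw dx (truncate (window N) P) x)
               (fun x => u x - pw dx (truncate (window N) P) x))
  = (fun N => ip mu u u - series (fun n => cellN dx P (Posz n) + cellN dx P (Negz n)) N).
  apply/funext => N; have sT := L2pw_truncate dx0 P (uniq_window N).
  rewrite -big_window -(ip_truncate_self dx0 P (uniq_window N)).
  rewrite /ip -RintegralB//; [|exact: sqint_integrableM..].
  apply: eq_Rintegral => x _; rewrite truncate_idem mulrBl !mulrBr truncate_idem.
  by rewrite [_ * u x]mulrC; ring.
by rewrite -(subrr (ip mu u u)); apply: cvgB; [exact: cvg_cst|exact: cellN_cvg].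
Qed.

(** The error is the form applied to the truncation remainder. Cauchy-Schwarz and the seminorm
    bound, valid because the remainder is again in [V^k], reduce it to the L^2 convergence of
    truncations. *)
Lemma fracform_cells_cvg :
  series (fun n => fracform c lam (cellfun dx (Posz n) (P (Posz n))) u
                 + fracform c lam (cellfun dx (Negz n) (P (Negz n))) u) @ \oo
  --> fracform c lam u u.
Proof.
pose d N := fun x => u x - pw dx (truncate (window N) P) x.
have dE N : d N = pw dx (fun i => P i - truncate (window N) P i).
  by apply/funext => x; rewrite /d /pw hornerD hornerN.
have Vd N : inVk k (fun i => P i - truncate (window N) P i).
  move=> i; rewrite (leq_trans (size_polyD _ _))// size_polyN geq_max VP.
  exact: (inVk_truncate (window N) VP).
have sT N := L2pw_truncate dx0 P (uniq_window N).
have sd N : L2pw dx (fun i => P i - truncate (window N) P i).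
  by rewrite /L2pw -dE; apply: sqintB => //; exact: sT.
have [K K0 HK] := ip_gagliardo_le k lam01 dx0.
have gu := sqint_gagliardo lam01 dx0 VP sP.
have gd N := sqint_gagliardo lam01 dx0 (Vd N) (sd N).
have gT N := sqint_gagliardo lam01 dx0 (inVk_truncate (window N) VP) (sT N).
apply/cvgrPdist_le => e e0.
pose B := (c / 2) ^+ 2 * (K * ip mu2 (gagliardo lam u) (gagliardo lam u)).
have B0 : 0 <= B by rewrite mulr_ge0 ?sqr_ge0// mulr_ge0// ip_ge0.
have e2 : 0 < e ^+ 2 / (B + 1) by rewrite divr_gt0 ?exprn_gt0// ltr_wpDl.
have /cvgrPdist_le/(_ _ e2) := truncate_window_cvg.
apply: filterS => N; rewrite sub0r normrN => hN.
have -> : fracform c lam u u - series (fun n => fracform c lam (cellfun dx (Posz n) (P (Posz n))) u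
    + fracform c lam (cellfun dx (Negz n) (P (Negz n))) u) N
  = - (c / 2) * ip mu2 (gagliardo lam (d N)) (gagliardo lam u).
  rewrite -(big_window (fun i => fracform c lam (cellfun dx i (P i)) u)).
  rewrite (fracform_truncate lam01 dx0 c (uniq_window N) VP VP sP).
  rewrite !(fracformE lam01) -mulrBr; congr (_ * _).
  rewrite -(ipBl gu (gT N) gu) /ip; apply: eq_Rintegral => p _.
  by rewrite gagliardoB.
rewrite -[leLHS]ger0_norm// -ler_sqr ?nnegrE ?(ltW e0)// normr_id real_normK ?num_real//.
rewrite exprMn sqrrN.
have cs : ip mu2 (gagliardo lam (d N)) (gagliardo lam u) ^+ 2
    <= ip mu2 (gagliardo lam (d N)) (gagliardo lam (d N)) * ip mu2 (gagliardo lam u) (gagliardo lam u).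
  by rewrite dE; apply: ip_CauchySchwarz.
apply: (@le_trans _ _ ((c / 2) ^+ 2 * (K * ip mu (d N) (d N) * ip mu2 (gagliardo lam u) (gagliardo lam u)))).
  rewrite ler_wpM2l ?sqr_ge0// (le_trans cs)// ler_wpM2r ?ip_ge0//.
  by rewrite dE; exact: HK.
have -> : (c / 2) ^+ 2 * (K * ip mu (d N) (d N) * ip mu2 (gagliardo lam u) (gagliardo lam u)) = B * ip mu (d N) (d N).
  by rewrite /B; ring.
have hN' : ip mu (d N) (d N) <= e ^+ 2 / (B + 1) by apply: le_trans (ler_norm _) hN.
apply: (@le_trans _ _ (B * (e ^+ 2 / (B + 1)))); first by rewrite ler_wpM2l.
rewrite mulrA ler_pdivrMr ?ltr_wpDl// mulrC ler_wpM2l ?sqr_ge0//.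
by rewrite lerDl.
Qed.

End window_limits.

(** * The energy inequality at a fixed time *)

Lemma PoszS (n : nat) : Posz n.+1 = Posz n + 1.
Proof. lia. Qed.

Lemma oppPoszS (n : nat) : - Posz n.+1 = Negz n.+1 + 1.
Proof. lia. Qed.

(** [X] is a limit, [S] a partial sum and [z - y] the boundary terms; the sum of the errors is
    [3 ep / 4]. *)
Lemma le_of_partial_sum (R : realFieldType) (X S z y ep : R) :
  `|z| <= ep / 8 -> `|y| <= ep / 8 -> S <= z - y -> `|X - S| <= ep / 2 -> X <= ep.
Proof.
by rewrite !ler_norml => /andP[? ?] /andP[? ?] ? /andP[? ?]; lra.
Qed.

Section energy_inequality.
Variables (R : realType) (lam dx b c : R) (k : nat).
Hypotheses (lam01 : 0 < lam < 1) (dx0 : 0 < dx).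
Local Notation mu := (@lebesgue_measure R).
Local Notation mu2 := (mu \x mu)%E.
Variables (f a : R -> R) (fhat : R -> R -> R) (L : R) (h : int -> R).
Hypotheses (fL : forall x y, `|f x - f y| <= L * `|x - y|) (f0 : f 0 = 0).
Hypotheses (fhatE : forall v, fhat v v = f v)
  (fhat1 : forall x x' y, x <= x' -> fhat x y <= fhat x' y)
  (fhat2 : forall x y y', y <= y' -> fhat x y' <= fhat x y).
Variables P Q : int -> {poly R}.
Hypotheses (VP : inVk k P) (sP : L2pw dx P) (sQ : L2pw dx Q).
Local Notation u := (pw dx P).
Local Notation m := (trm dx P).
Local Notation p := (trp dx P).
Local Notation J := (jump dx P).
Hypothesis scheme : forall (i : int) (q : {poly R}), (size q <= k.+1)%N ->
  \int[mu]_(x in cell dx i) ((Q i).[x] * q.[x])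
  - \int[mu]_(x in cell dx i) (f (P i).[x] * (q^`()).[x])
  + fhat (m (i + 1)) (p (i + 1)) * q.[node dx (i + 1)]
  - fhat (m i) (p i) * q.[node dx i]
  + \int[mu]_(x in cell dx i) (a (P i).[x] * ((P i)^`()).[x] * (q^`()).[x])
  - h (i + 1) * q.[node dx (i + 1)] + h i * q.[node dx i]
  = b * fracform c lam (cellfun dx i q) u.

Let E := ip mu u u.
(** The total flux through node [i]. Here [h] is an arbitrary sequence: its structure enters only
    through admissibility, after the sums have been formed. *)
Let W i := fhat (m i) (p i) - h i.
Let one : int -> {poly R} := fun=> 1.

Let Vone : inVk k one.
Proof. by move=> i; rewrite size_poly1. Qed.

Let cellN_one i : cellN dx one i = dx.
Proof.
rewrite /cellN; under eq_Rintegral do rewrite /one hornerC expr1n.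
rewrite Rintegral_cst; last exact: measurable_cell.
by rewrite [X in fine X]lebesgue_measure_cell// mul1r.
Qed.

(** The test function 1 kills both volume terms, so flux differences equal the nonlocal term minus
    the time derivative. After summation over [s], Cauchy-Schwarz pairs each with the indicator of
    the cells in [s], whose squared norm is [dx] times their number. *)
Let total_flux_bound : exists2 A : R, 0 <= A &
  forall s, uniq s -> (\sum_(i <- s) (W (i + 1) - W i)) ^+ 2 <= A * (size s)%:R.
Proof.
have [K K0 HK] := ip_gagliardo_le k lam01 dx0.
have gu := sqint_gagliardo lam01 dx0 VP sP.
pose H := ip mu2 (gagliardo lam u) (gagliardo lam u).
pose q := ip mu (pw dx Q) (pw dx Q).
have H0 : 0 <= H by exact: ip_ge0.
have q0 : 0 <= q by exact: ip_ge0.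
exists (2 * dx * ((b * c / 2) ^+ 2 * K * H + q)).
  apply: mulr_ge0; first by rewrite mulr_ge0// ltW.
  by apply: addr_ge0 => //; apply: mulr_ge0 H0; apply: mulr_ge0 K0; exact: sqr_ge0.
move=> s us; have sT := L2pw_truncate dx0 one us.
have gT := sqint_gagliardo lam01 dx0 (inVk_truncate s Vone) sT.
have n1 : ip mu (pw dx (truncate s one)) (pw dx (truncate s one)) = dx * (size s)%:R.
  rewrite (ip_truncate_self dx0 one us); under eq_bigr do rewrite cellN_one.
  by rewrite big_const_seq count_predT iter_addr addr0 mulr_natr.
set G := ip mu2 (gagliardo lam (pw dx (truncate s one))) (gagliardo lam u).
set B := ip mu (pw dx Q) (pw dx (truncate s one)).
have -> : \sum_(i <- s) (W (i + 1) - W i) = - (b * c / 2) * G - B.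
  transitivity (\sum_(i <- s) (b * fracform c lam (cellfun dx i (one i)) u
       - \int[mu]_(x in cell dx i) ((Q i).[x] * (one i).[x]))).
    apply: eq_bigr => i _; rewrite -(scheme i (Vone i)) /W /one.
    have d1 : (1 : {poly R})^`() = 0 by rewrite -(polyC1 R) derivC.
    have h1 y : (1 : {poly R}).[y] = 1 by rewrite -(polyC1 R) hornerC.
    have z1 (g : R -> R) : \int[mu]_(x in cell dx i) (g x * ((1 : {poly R})^`()).[x]) = 0.
      by under eq_Rintegral do rewrite d1 horner0 mulr0; rewrite /Rintegral integral0.
    rewrite (z1 (fun x => f (P i).[x])) (z1 (fun x => a (P i).[x] * ((P i)^`()).[x])) !h1.
    by ring.
  rewrite sumrB -mulr_sumr (fracform_truncate lam01 dx0 c us Vone VP sP).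
  rewrite -(ip_truncate dx0 one us sQ) (fracformE lam01) -/G -/B; congr (_ - _).
  by field.
have hG : G ^+ 2 <= K * (dx * (size s)%:R) * H.
  apply: (le_trans (ip_CauchySchwarz gT gu)); rewrite ler_wpM2r//.
  by rewrite -n1; apply: HK => //; exact: inVk_truncate.
have hB : B ^+ 2 <= q * (dx * (size s)%:R).
  by rewrite -n1; exact: ip_CauchySchwarz.
apply: (@le_trans _ _ (2 * (b * c / 2) ^+ 2 * G ^+ 2 + 2 * B ^+ 2)).
  by have := sqr_ge0 (b * c / 2 * G - B); nra.
have -> : 2 * dx * ((b * c / 2) ^+ 2 * K * H + q) * (size s)%:R
  = 2 * (b * c / 2) ^+ 2 * (K * (dx * (size s)%:R) * H) + 2 * (q * (dx * (size s)%:R)).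
  by ring.
by apply: lerD; apply: ler_wpM2l => //; apply: mulr_ge0 => //; exact: sqr_ge0.
Qed.

(* Test functions equal to 1 on N consecutive cells show that the total flux
   grows at most like sqrt N, with no regularity of [a] needed. *)
Let flux_growth : exists2 A : R, 0 <= A & forall N : nat,
  W (Posz N) ^+ 2 <= A * N.+1%:R /\ W (- Posz N) ^+ 2 <= A * N.+1%:R.
Proof.
have [A A0 HA] := total_flux_bound.
(* From [W N = W 0 + (W N - W 0)], the square is at most [2 W 0 ^+ 2 + 2 A N]. *)
exists (2 * W 0 ^+ 2 + 2 * A); first by apply: addr_ge0; apply: mulr_ge0 => //; exact: sqr_ge0.
move=> N; have N0 : 0 <= N%:R :> R by rewrite ler0n.
have w0 := sqr_ge0 (W 0); have AN := mulr_ge0 A0 N0.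
have wN := mulr_ge0 w0 N0.
rewrite -[N.+1]addn1 natrD; split.
  have := HA _ (uniq_posw N); rewrite telescope_posw size_map size_iota => hN.
  have := sqr_ge0 (W (Posz N) - 2 * W 0); nra.
have := HA _ (uniq_negw N); rewrite telescope_negw size_map size_iota => hN.
have := sqr_ge0 (W (- Posz N) - 2 * W 0); nra.
Qed.

Let cellN_le i : cellN dx P i <= E.
Proof.
rewrite -lee_fin -integral_cell_sqr// /E -(ipE sP).
apply: ge0_subset_integral => //.
- exact: measurable_cell.
- by apply/measurable_EFinP; apply: measurable_funX; exact: measurable_pw.
- by move=> x _; rewrite lee_fin sqr_ge0.
Qed.

Let local_bound : exists2 C : R, 0 <= C & forall i,
  (forall x, node dx i <= x <= node dx (i + 1) -> (P i).[x] ^+ 2 <= C * cellN dx P i).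
Proof.
have [C C0 HC] := inverse_inequality k dx0; exists C => // i x.
by rewrite nodeS /cellN cellE => xi; have [hx _] := HC (node dx i) _ (VP i); exact: hx.
Qed.

(** Each cell contributes at most an increment of [Z], the discarded part being the entropy
    production at its left node. Partial sums are then bounded by two values of [Z], which are small
    along a subsequence, while the whole series converges. *)
Lemma energy_inequality : zsummable (term_a a dx P) -> zsummable (fun i => h i * J i) ->
  ip mu (pw dx Q) u + zsum (term_a a dx P) + zsum (fun i => h i * J i)
  - b * fracform c lam u u <= 0.
Proof.
move=> ca ch; have E0 : 0 <= E by exact: ip_ge0.
have [C C0 HC] := local_bound; have [A A0 HA] := flux_growth.
(* Every real satisfies [|y| < 1 + y ^+ 2], so this strictly bounds all values on the closed cells
   without a square root. *)
pose M := 1 + C * E.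
have ltM y : y ^+ 2 <= C * E -> `|y| < M.
  move=> yE; rewrite /M; have := real_normK (num_real y).
  move: (`|y|) => z zy; rewrite -zy in yE.
  by have := sqr_ge0 (z - 1); nra.
have [F [F0 dF]] := continuous_primitive M (lipschitz_continuous fL).
have PM i x : node dx i <= x <= node dx (i + 1) -> `|(P i).[x]| < M.
  by move=> xi; apply: ltM; rewrite (le_trans (HC i x xi))// ler_wpM2l.
have node_le i : node dx i <= node dx (i + 1) by rewrite nodeS lerDl ltW.
have pM i : `|p i| < M by apply: PM; rewrite lexx node_le.
have m2 i : m (i + 1) ^+ 2 <= C * cellN dx P i.
  by rewrite /trm addrK; apply: HC; rewrite lexx node_le.
have mM i : `|m i| < M.
  by rewrite -(subrK 1 i); apply: ltM; rewrite (le_trans (m2 _))// ler_wpM2l.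
(* Built from left traces only: moving [F] and [W] from the right to the left trace at node [i]
   costs the E-flux defect and the term [h i * J i], which is why the latter appears in [e]. *)
pose Z i := F (m i) - W i * m i.
pose e i := \int[mu]_(x in cell dx i) ((Q i).[x] * (P i).[x]) + term_a a dx P i
   + h i * J i - b * fracform c lam (cellfun dx i (P i)) u.
have eZ i : e i <= Z (i + 1) - Z i.
  have := scheme i (VP i); rewrite {2}/cell.
  have nlt : node dx i < node dx (i + 1) by rewrite nodeS ltrDl.
  rewrite (Rintegral_flux fL dF nlt (PM i)).
  have -> : \int[mu]_(x in cell dx i) (a (P i).[x] * ((P i)^`()).[x] * ((P i)^`()).[x])
      = term_a a dx P i.
    by apply: eq_Rintegral => x _; rewrite expr2 mulrA.
  have -> : (P i).[node dx i] = p i by [].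
  have -> : (P i).[node dx (i + 1)] = m (i + 1) by rewrite /trm addrK.
  move=> sc; rewrite /e -sc /Z /W /jump.
  have := monotone_flux_le dF fhatE fhat1 fhat2 (mM i) (pM i).
  rewrite -subr_ge0 => key; rewrite -subr_ge0.
  by apply: (le_trans key); rewrite le_eqVlt; apply/orP; left; apply/eqP; ring.
pose X := ip mu (pw dx Q) u + zsum (term_a a dx P) + zsum (fun i => h i * J i)
  - b * fracform c lam u u.
have cvX : series (fun n => e (Posz n) + e (Negz n)) @ \oo --> X.
  pose qp i := \int[mu]_(x in cell dx i) ((Q i).[x] * (P i).[x]).
  pose fr i := fracform c lam (cellfun dx i (P i)) u.
  pose S (g : int -> R) := series (fun n => g (Posz n) + g (Negz n)).
  have -> : series (fun n => e (Posz n) + e (Negz n))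
      = (fun n => S qp n + S (term_a a dx P) n + S (fun i => h i * J i) n - b * S fr n).
    apply/funext => n; rewrite /S /series /= mulr_sumr -!big_split -sumrB /=.
    by apply: eq_bigr => i _; rewrite /e /qp /fr; ring.
  apply: cvgB; last by apply: cvgMl_tmp; exact: (fracform_cells_cvg (k := k)).
  apply: cvgD; last exact: zsum_cvg.
  by apply: cvgD; [exact: ip_cells_cvg|exact: zsum_cvg].
have leZ N : series (fun n => e (Posz n) + e (Negz n)) N <= Z (Posz N) - Z (- Posz N).
  rewrite -telescope_zsum; apply: ler_sum => n _; exact: lerD.
have L0 : 0 <= L by have := le_trans (normr_ge0 _) (fL 1 0); rewrite subr0 normr1 mulr1.
pose v n := cellN dx P (Posz n) + cellN dx P (Negz n).
have v0 n : 0 <= v n by rewrite addr_ge0 ?cellN_ge0.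
have cv : cvgn (series v) by apply/cvg_ex; eexists; exact: (cellN_cvg dx0 sP).
(* The left traces at nodes [n + 1] and [- (n + 1)] belong to the cells [n] and [- (n + 2)], which
   lie in the pairs [n] and [n + 1]. With [w] a single index serves both ends. *)
pose w n := v n + v n.+1.
have w0 n : 0 <= w n by rewrite addr_ge0.
have cw : cvgn (series w).
  have -> : series w = series v + (fun n => series v n.+1 - v 0%N).
    apply/funext => n; rewrite fctE; elim: n => [|n IH].
      by rewrite seriesSr /series /= !big_geq// add0r add0r subrr.
    rewrite (seriesSr w) IH (seriesSr v n) [in RHS](seriesSr v n.+1) (seriesSr v n) /w; ring.
  apply: is_cvgD => //; apply: is_cvgB; last exact: is_cvg_cst.
  by have /cvg_ex[l vl] := cv; apply/cvg_ex; exists l; rewrite (cvg_shiftS (series v)).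
rewrite -/X; apply/ler_addgt0Pr => ep ep0; rewrite add0r.
have LC0 : 0 <= L * C by exact: mulr_ge0.
have AC0 : 0 <= 2 * A * C by rewrite !mulr_ge0.
(* The first threshold makes [F] at the trace at most [ep / 16], the second does so for the flux
   times the trace, via its square. The factor 2 pays for replacing [n + 1] by [n + 2]; adding 1
   keeps the denominators positive. *)
pose d := Num.min (ep / 16 / (L * C + 1)) ((ep / 16) ^+ 2 / (2 * A * C + 1)).
have d0 : 0 < d by rewrite lt_min !divr_gt0 ?exprn_gt0 ?divr_gt0// ltr_wpDl.
have dL : L * C * d <= ep / 16.
  apply: (@le_trans _ _ (L * C * (ep / 16 / (L * C + 1)))).
    by rewrite ler_wpM2l// ge_min lexx.
  by rewrite mulrA ler_pdivrMr ?ltr_wpDl// mulrC ler_wpM2l ?divr_ge0 ?(ltW ep0)// lerDl.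
have dA : 2 * A * C * d <= (ep / 16) ^+ 2.
  apply: (@le_trans _ _ (2 * A * C * ((ep / 16) ^+ 2 / (2 * A * C + 1)))).
    by rewrite ler_wpM2l// ge_min lexx orbT.
  by rewrite mulrA ler_pdivrMr ?ltr_wpDl// mulrC ler_wpM2l ?sqr_ge0// lerDl.
have ep2 : 0 < ep / 2 by rewrite divr_gt0.
have /cvgrPdist_le/(_ _ ep2)[N0 _ HN0] := cvX.
have [n [nN0 nw]] := summable_harmonic_small N0 w0 cw d0.
have wd : w n <= d by rewrite (le_trans _ nw)// ler_peMl// ler1n.
have Zle j : m j ^+ 2 <= C * w n -> W j ^+ 2 <= A * n.+2%:R -> `|Z j| <= ep / 8.
  move=> mw Ww; rewrite /Z (le_trans (ler_normB _ _))//.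
  have -> : ep / 8 = ep / 16 + ep / 16 by field.
  apply: lerD.
    apply: (le_trans (primitive_quadratic fL f0 F0 dF (mM j))).
    apply: le_trans dL; rewrite -mulrA ler_wpM2l// (le_trans mw)// ler_wpM2l//.
  rewrite -ler_sqr ?nnegrE ?divr_ge0 ?(ltW ep0)// real_normK ?num_real// exprMn.
  apply: (le_trans _ dA); apply: (@le_trans _ _ (A * n.+2%:R * (C * w n))).
    by apply: ler_pM; rewrite ?sqr_ge0.
  have -> : A * n.+2%:R * (C * w n) = A * C * (n.+2%:R * w n) by ring.
  have -> : 2 * A * C * d = A * C * (2 * d) by ring.
  rewrite ler_wpM2l ?mulr_ge0// -[n.+2]addn1 natrD mulrDl mul1r.
  have -> : 2 * d = d + d by ring.
  exact: lerD.
have le_w i : i = Posz n \/ i = Negz n.+1 -> cellN dx P i <= w n.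
  have := cellN_ge0 dx P (Posz n); have := cellN_ge0 dx P (Negz n).
  have := cellN_ge0 dx P (Posz n.+1); have := cellN_ge0 dx P (Negz n.+1).
  by move=> ? ? ? ? [->|->]; rewrite /w /v; lra.
have [Wp Wn] := HA n.+1.
have Zp : `|Z (Posz n.+1)| <= ep / 8.
  apply: Zle => //; rewrite PoszS.
  by rewrite (le_trans (m2 _))// ler_wpM2l// le_w//; left.
have Zn : `|Z (- Posz n.+1)| <= ep / 8.
  apply: Zle => //; rewrite oppPoszS.
  by rewrite (le_trans (m2 _))// ler_wpM2l// le_w//; right.
exact: le_of_partial_sum Zp Zn (leZ n.+1) (HN0 n.+1 (leqW nN0)).
Qed.

End energy_inequality.

(** * Integration in time *)

Section time_regularity.
Variables (R : realType) (T : R).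

Definition near_on (t : R) (A : R -> Prop) : Prop :=
  exists2 d : R, 0 < d & forall s : R, s \in `[0, T] -> `|s - t| < d -> A s.

Lemma near_onI t (A B : R -> Prop) :
  near_on t A -> near_on t B -> near_on t (fun s => A s /\ B s).
Proof.
move=> [d1 d10 h1] [d2 d20 h2]; exists (Num.min d1 d2); first by rewrite lt_min d10.
by move=> s sT; rewrite lt_min => /andP[? ?]; split; [exact: h1|exact: h2].
Qed.

Lemma near_on_mono t (A B : R -> Prop) :
  (forall s, s \in `[0, T] -> A s -> B s) -> near_on t A -> near_on t B.
Proof. by move=> AB [d d0 h]; exists d => // s sT sd; apply: AB => //; exact: h. Qed.

Definition cont_on (g : R -> R) : Prop :=
  forall t, t \in `[0, T] -> forall e, 0 < e -> near_on t (fun s => `|g s - g t| <= e).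

Lemma cont_on_within (g : R -> R) : cont_on g -> {within `[0, T], continuous g}.
Proof.
move=> cg; apply/subspace_continuousP => t tT; apply/cvgrPdist_le => e e0.
have [d d0 h] := cg t tT e e0.
rewrite near_withinE; apply/nbhs_ballP; exists d => //= s.
by rewrite /ball/= distrC => sd sT; rewrite distrC; exact: h.
Qed.

(** Turns a Cauchy-Schwarz bound [x ^+ 2 <= A * D] into smallness of [x]; the [A + 1] in the
    threshold covers [A = 0]. *)
Lemma sqr_small (A e : R) : 0 <= A -> 0 < e -> exists2 d : R, 0 < d &
  forall x D, x ^+ 2 <= A * D -> D <= d -> `|x| <= e.
Proof.
move=> A0 e0; exists (e ^+ 2 / (A + 1)).
  by rewrite divr_gt0 ?exprn_gt0// ltr_wpDl.
move=> x D xD Dd; rewrite -ler_sqr ?nnegrE ?(ltW e0)// real_normK ?num_real//.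
apply: (le_trans xD); apply: (@le_trans _ _ (A * (e ^+ 2 / (A + 1)))).
  exact: ler_wpM2l.
rewrite mulrA ler_pdivrMr ?ltr_wpDl// mulrC ler_wpM2l ?sqr_ge0//.
by rewrite lerDl.
Qed.

Section square_integrable_curves.
Context d (X : measurableType d) (m : {measure set X -> \bar R}).

Definition L2cont (F : R -> X -> R) : Prop :=
  forall t, t \in `[0, T] -> forall e, 0 < e ->
    near_on t (fun s => ip m (fun x => F s x - F t x) (fun x => F s x - F t x) <= e).

Lemma ip_cont_on (F1 F2 : R -> X -> R) :
  (forall t, t \in `[0, T] -> sqint m (F1 t)) ->
  (forall t, t \in `[0, T] -> sqint m (F2 t)) ->
  L2cont F1 -> L2cont F2 -> cont_on (fun t => ip m (F1 t) (F2 t)).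
Proof.
move=> s1 s2 c1 c2 t tT e e0.
have e3 : 0 < e / 3 by rewrite divr_gt0.
have [d0 d00 h0] := sqr_small (ler01 : 0 <= 1 :> R) e3.
have [d1 d10 h1] := sqr_small (ip_ge0 m (F2 t)) e3.
have [d2 d20 h2] := sqr_small (ip_ge0 m (F1 t)) e3.
have m0 : 0 < Num.min d0 d1 by rewrite lt_min d00.
(* With the second increment bounded by 1, the product of the two increments is governed by the
   first alone. *)
have m1 : 0 < Num.min 1 d2 by rewrite lt_min ltr01.
apply: near_on_mono (near_onI (c1 t tT _ m0) (c2 t tT _ m1)) => s sT [].
rewrite !le_min => /andP[a0 a1] /andP[b1 b2].
have D1 := sqintB (s1 s sT) (s1 t tT); have D2 := sqintB (s2 s sT) (s2 t tT).
(* Expanding around [t] leaves only fixed functions beside the increments, so the thresholds do not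
   depend on [s]. *)
have -> : ip m (F1 s) (F2 s) - ip m (F1 t) (F2 t)
  = ip m (fun x => F1 s x - F1 t x) (fun x => F2 s x - F2 t x)
  + ip m (fun x => F1 s x - F1 t x) (F2 t)
  + ip m (F1 t) (fun x => F2 s x - F2 t x).
  rewrite !(ipBl (s1 s sT) (s1 t tT))//; last exact: s2.
  rewrite !(ipC m _ (fun x => F2 s x - F2 t x)) !(ipBl (s2 s sT) (s2 t tT));
    try exact: s1.
  rewrite !(ipC m (F2 _)); ring.
have x0 := h0 _ _ _ a0; have x1 := h1 _ _ _ a1; have x2 := h2 _ _ _ b2.
have y0 : `|ip m (fun x => F1 s x - F1 t x) (fun x => F2 s x - F2 t x)| <= e / 3.
  apply: x0; apply: (le_trans (ip_CauchySchwarz D1 D2)).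
  by rewrite mulrC ler_wpM2r// ip_ge0.
have y1 : `|ip m (fun x => F1 s x - F1 t x) (F2 t)| <= e / 3.
  by apply: x1; rewrite mulrC; apply: ip_CauchySchwarz => //; exact: s2.
have y2 : `|ip m (F1 t) (fun x => F2 s x - F2 t x)| <= e / 3.
  by apply: x2; apply: ip_CauchySchwarz => //; exact: s1.
have -> : e = e / 3 + e / 3 + e / 3 by field.
apply: (le_trans (ler_normD _ _)); apply: lerD => //.
by apply: (le_trans (ler_normD _ _)); exact: lerD.
Qed.

Variables (u v : R -> X -> R).
Hypotheses (su : forall t, t \in `[0, T] -> sqint m (u t))
           (sv : forall t, t \in `[0, T] -> sqint m (v t)).
Hypothesis duv : forall t, t \in `[0, T] -> forall e : R, 0 < e ->
  exists2 d : R, 0 < d & forall h : R, h != 0 -> `|h| < d -> t + h \in `[0, T] ->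
    ip m (fun x => (u (t + h) x - u t x) / h - v t x)
         (fun x => (u (t + h) x - u t x) / h - v t x) <= e.

Let r t h := fun x => (u (t + h) x - u t x) / h - v t x.

Let sr t h : t \in `[0, T] -> t + h \in `[0, T] -> sqint m (r t h).
Proof.
move=> tT hT; apply: sqintB (sv tT).
have := sqintZ h^-1 (sqintB (su hT) (su tT)).
by congr sqint; apply/funext => x; rewrite mulrC.
Qed.

Let ipD_le f g : sqint m f -> sqint m g ->
  ip m (fun x => f x + g x) (fun x => f x + g x) <= 2 * ip m f f + 2 * ip m g g.
Proof.
move=> sf sg; have e1 := ip_sqrD 1 sf sg; have e2 := ip_sqrD (- 1) sf sg.
have -> : (fun x => f x + g x) = (fun x => f x + 1 * g x).
  by apply/funext => x; rewrite mul1r.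
rewrite e1; have := ip_ge0 m (fun x => f x + -1 * g x).
rewrite e2; lra.
Qed.

Let uE t h x : h != 0 -> u (t + h) x = u t x + h * (v t x + r t h x).
Proof. by move=> h0; rewrite /r; field. Qed.

Lemma differentiable_L2cont : L2cont u.
Proof.
move=> t tT e e0; have [d1 d10 H] := duv tT ltr01.
(* The increment is [h * (v + r)]; [B] bounds the squared norm of [v + r] once the remainder [r] has
   squared norm at most 1. *)
pose B := 2 * ip m (v t) (v t) + 2.
have B0 : 0 < B by rewrite /B ltr_wpDl// mulr_ge0// ip_ge0.
exists (Num.min d1 (Num.min 1 (e / B))); first by rewrite !lt_min d10 ltr01 divr_gt0.
move=> s sT; rewrite !lt_min => /and3P[sd1 s1 sB].
have [->|st] := eqVneq s t.
  rewrite /ip; under eq_Rintegral do rewrite subrr mul0r.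
  by rewrite /Rintegral integral0 ltW.
have h0 : s - t != 0 by rewrite subr_eq0.
have sE : s = t + (s - t) by ring.
have hT : t + (s - t) \in `[0, T] by rewrite -sE.
have svr := sqintD (sv tT) (sr tT hT).
have -> : (fun x => u s x - u t x) = (fun x => (s - t) * (v t x + r t (s - t) x)).
  by apply/funext => x; rewrite {1}sE uE//; ring.
rewrite ipZl//; last exact: sqintZ.
rewrite ipC ipZl// mulrA.
have q1 : ip m (fun x => v t x + r t (s - t) x) (fun x => v t x + r t (s - t) x) <= B.
  apply: (le_trans (ipD_le (sv tT) (sr tT hT))); rewrite /B lerD2l.
  by rewrite -[leRHS]mulr1 ler_wpM2l//; apply: H.
have hh : (s - t) * (s - t) <= e / B.
  rewrite -expr2 -real_normK ?num_real// expr2.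
  by apply: (le_trans _ (ltW sB)); rewrite ler_piMl// ltW.
apply: (le_trans (ler_pM _ (ip_ge0 _ _) hh q1)); first by rewrite -expr2 sqr_ge0.
by rewrite divfK// gt_eqF.
Qed.

(** Expanding the square of [u + h * (v + r)] leaves the error [2 <r, u> + h |v + r|^2]. Only L^2
    convergence of difference quotients is used, with no differentiation under the integral. *)
Lemma is_derive_ip_sqr t : t \in `]0, T[ ->
  is_derive t 1 (fun s => ip m (u s) (u s)) (2 * ip m (v t) (u t)).
Proof.
move=> t0T; have tT : t \in `[0, T] by exact: subset_itv_oo_cc t0T.
have cvq : (fun h => h^-1 *: (ip m (u (h *: 1 + t)) (u (h *: 1 + t)) - ip m (u t) (u t)))
    @ 0^' --> 2 * ip m (v t) (u t).
  apply/cvgrPdist_le => e e0.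
  have e4 : 0 < e / 4 by rewrite divr_gt0.
  have [d0 d00 h0] := sqr_small (ip_ge0 m (u t)) e4.
  have min0 : 0 < Num.min 1 d0 by rewrite lt_min ltr01.
  have [d1 d10 H] := duv tT min0.
  pose B := 2 * ip m (v t) (v t) + 2.
  have B0 : 0 < B by rewrite /B ltr_wpDl// mulr_ge0// ip_ge0.
  have /andP[t0 tlT] : 0 < t < T by move: t0T; rewrite in_itv.
  pose dd := Num.min d1 (Num.min (e / 2 / B) (Num.min t (T - t))).
  have dd0 : 0 < dd by rewrite !lt_min d10 t0 subr_gt0 tlT !divr_gt0.
  rewrite near_withinE; apply/nbhs_ballP; exists dd => //= h.
  rewrite /ball/= sub0r normrN !lt_min => /and4P[hd1 hB ht htT] hn0.
  have htI : t + h \in `[0, T].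
    move: ht htT; rewrite !ltr_norml in_itv/= => /andP[? ?] /andP[? ?].
    by apply/andP; split; lra.
  have rE := sr tT htI; have svr := sqintD (sv tT) rE.
  have Hr : ip m (r t h) (r t h) <= Num.min 1 d0 by exact: H.
  have [Hr1 Hrd] : ip m (r t h) (r t h) <= 1 /\ ip m (r t h) (r t h) <= d0.
    by move: Hr; rewrite le_min => /andP[].
  have -> : h *: 1 + t = t + h by rewrite /GRing.scale/= mulr1 addrC.
  have -> : u (t + h) = (fun x => u t x + h * (v t x + r t h x)).
    by apply/funext => x; exact: uE.
  rewrite (ip_sqrD h (su tT) svr) (ipC m (u t)) (ipDl (sv tT) rE (su tT)).
  set V := ip m (fun x => v t x + r t h x) (fun x => v t x + r t h x).
  have -> : 2 * ip m (v t) (u t) - h^-1 *: (ip m (u t) (u t)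
      + 2 * h * (ip m (v t) (u t) + ip m (r t h) (u t)) + h ^+ 2 * V - ip m (u t) (u t))
    = - (2 * ip m (r t h) (u t) + h * V).
    by rewrite /GRing.scale/=; field.
  rewrite normrN; apply: (le_trans (ler_normD _ _)).
  have VB : V <= B.
    apply: (le_trans (ipD_le (sv tT) rE)); rewrite /B lerD2l.
    by rewrite -[leRHS]mulr1 ler_wpM2l.
  have V0 : 0 <= V by exact: ip_ge0.
  have y1 : `|ip m (r t h) (u t)| <= e / 4.
    by apply: (h0 _ (ip m (r t h) (r t h))) => //; rewrite mulrC;
      apply: ip_CauchySchwarz => //; exact: su.
  have y2 : `|h * V| <= e / 2.
    rewrite normrM (ger0_norm V0).
    apply: (le_trans (ler_pM _ V0 (ltW hB) VB)) => //.
    by rewrite divfK// gt_eqF.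
  have -> : e = 2 * (e / 4) + e / 2 by field.
  by apply: lerD => //; rewrite normrM ger0_norm// ler_wpM2l.
split; first by apply/cvg_ex; eexists; exact: cvq.
by rewrite /derive; exact: cvg_lim cvq.
Qed.

Lemma integral_ip_derivative : 0 < T -> L2cont v ->
  (\int[@lebesgue_measure R]_(t in `[0%R, T]) (2 * ip m (v t) (u t))%:E
   = (ip m (u T) (u T) - ip m (u 0) (u 0))%:E)%E.
Proof.
move=> T0 cv; have cu := differentiable_L2cont.
have cg := cont_on_within (ip_cont_on su su cu cu).
have cG : {within `[0, T], continuous (fun t => 2 * ip m (v t) (u t))}.
  apply: cont_on_within => t tT e e0.
  have e2 : 0 < e / 2 by rewrite divr_gt0.
  apply: near_on_mono (ip_cont_on sv su cv cu tT e2) => s sT h.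
  by rewrite -mulrBr normrM ger0_norm// mulrC -ler_pdivlMr.
have [_ g0 gT] := (continuous_within_itvP _ T0).1 cg.
rewrite (@continuous_FTC2 _ (fun t => 2 * ip m (v t) (u t))
   (fun t => ip m (u t) (u t)) 0 T T0 cG) ?EFinB//.
- by split=> // x xT; have [] := is_derive_ip_sqr xT.
- by move=> x xT; rewrite derive1E; have [_] := is_derive_ip_sqr xT.
Qed.

End square_integrable_curves.
End time_regularity.

(** * Integrating an almost everywhere inequality, and the initial projection *)

Section time_integration.
Variable R : realType.
Local Notation mu := (@lebesgue_measure R).

Lemma ae_le0_Rintegral (T : R) (Phi : R -> R) :
  mu.-integrable `[0, T] (EFin \o Phi) ->
  {ae mu, forall t, t \in `]0, T[ -> Phi t <= 0} ->
  \int[mu]_(t in `[0, T]) Phi t <= 0.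
Proof.
move=> iPhi ae0; have mPhi := measurable_int _ iPhi.
have sub : `]0, T[%classic `<=` `[0, T]%classic by exact: subset_itv_oo_cc.
have mo : measurable_fun `]0, T[ (EFin \o Phi) by exact: measurable_funS mPhi.
have ni : (0 <= \int[mu]_(t in `]0%R, T[) `|(Phi t)%:E|)%E by exact: integral_ge0.
rewrite /Rintegral integral_itv_bndoo//.
(* [Phi] agrees almost everywhere with [- |Phi|], which is nonpositive at every point. *)
have -> : (\int[mu]_(t in `]0%R, T[) (Phi t)%:E
         = \int[mu]_(t in `]0%R, T[) (- `|(Phi t)%:E|))%E.
  apply: ae_eq_integral => //.
  - by apply: measurableT_comp => //; apply: measurableT_comp.
  - have [N [mN N0 subN]] := ae0; exists N; split => // t /= nt.
    apply: subN => /= h; apply: nt => t0.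
    by rewrite ler0_norm ?EFinN ?oppeK// h.
rewrite integral_ge0N//.
by rewrite fineN oppr_le0 fine_ge0.
Qed.

Lemma cont_on_integrable (T : R) (g : R -> R) : cont_on T g ->
  mu.-integrable `[0, T] (EFin \o g).
Proof.
move=> cg; apply: continuous_compact_integrable; first exact: segment_compact.
exact: cont_on_within.
Qed.

(** On each cell, integrate [2 u0 P <= u0^2 + P^2]; testing the projection with [P] itself turns the
    left side into twice the integral of [P^2]. *)
Lemma L2_projection_le (dx : R) (u0 : R -> R) (P : int -> {poly R}) : 0 < dx ->
  measurable_fun setT u0 -> mu.-integrable setT (fun x => ((u0 x) ^+ 2)%:E) ->
  (forall i, \int[mu]_(x in cell dx i) ((P i).[x] * (P i).[x])
           = \int[mu]_(x in cell dx i) (u0 x * (P i).[x])) ->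
  (L2sq (pw dx P) <= L2sq u0)%E.
Proof.
move=> dx0 mu0 iu0 proj; apply: (ge0_le_integral_cells dx0).
- by apply/measurable_EFinP; apply: measurable_funX; exact: measurable_pw.
- by apply/measurable_EFinP; exact: measurable_funX.
- by move=> x; rewrite lee_fin sqr_ge0.
- by move=> x; rewrite lee_fin sqr_ge0.
move=> i; rewrite integral_cell_sqr//.
have mC : measurable (cell dx i : set (measurableTypeR R)) by exact: measurable_cell.
have ui : mu.-integrable (cell dx i) (EFin \o (fun x => u0 x ^+ 2)).
  exact: integrable_cell.
have cP : continuous (fun x : R => (P i).[x] ^+ 2).
  have -> : (fun x => (P i).[x] ^+ 2) = horner (P i ^+ 2).
    by apply/funext => y; rewrite horner_exp.
  exact: continuous_horner.
have Pi : mu.-integrable (cell dx i) (EFin \o (fun x => (P i).[x] ^+ 2)).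
  exact: continuous_integrable_oo.
have sumi : mu.-integrable (cell dx i) (EFin \o (fun x => u0 x ^+ 2 + (P i).[x] ^+ 2)).
  exact: (integrableD mC ui Pi).
have uPi : mu.-integrable (cell dx i) (EFin \o (fun x => u0 x * (P i).[x])).
  apply: (le_integrable mC _ _ sumi).
    apply/measurable_EFinP; apply: measurable_funTS; apply: measurable_funM => //.
    by apply: continuous_measurable_fun; exact: continuous_horner.
  move=> x _ /=; rewrite lee_fin [leRHS]ger0_norm ?addr_ge0 ?sqr_ge0//.
  by rewrite ler_norml; apply/andP; split; nra.
have -> : (\int[mu]_(x in cell dx i) ((u0 x) ^+ 2)%:E
         = (\int[mu]_(x in cell dx i) (u0 x ^+ 2))%:E)%E.
  by rewrite fineK//; exact: integrable_fin_num.
rewrite lee_fin; have NE : cellN dx P i = \int[mu]_(x in cell dx i) (u0 x * (P i).[x]).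
  by rewrite -proj; apply: eq_Rintegral => x _; rewrite expr2.
have : \int[mu]_(x in cell dx i) (2 * (u0 x * (P i).[x]))
    <= \int[mu]_(x in cell dx i) (u0 x ^+ 2 + (P i).[x] ^+ 2).
  apply: le_Rintegral => //.
    exact: (integrableZl mC 2 uPi).
  by move=> x _; have := sqr_ge0 (u0 x - (P i).[x]); nra.
rewrite RintegralD// RintegralZl// -NE -/(cellN dx P i); lra.
Qed.

End time_integration.

Unset Implicit Arguments.

(* P i t : polynomial piece of uhat(., t) on I_i;
   Q i t : polynomial piece of uhat_t(., t) on I_i (the C^1 time derivative). *)
Theorem mainTheorem1 (R : realType) (k : nat) (T dx : R)
    (f a : R -> R) (b lam c : R) (fhat : R -> R -> R) (beta : nat -> R)
    (gamma alpha : R) (u0 : R -> R) (P Q : int -> R -> {poly R}) :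
  0 < T -> 0 < dx ->
  (* f, a Lipschitz, a >= 0 bounded, f(0) = 0, a smooth enough *)
  (exists L : R, forall x y, `|f x - f y| <= L * `|x - y|) ->
  f 0 = 0 ->
  (exists L : R, forall x y, `|a x - a y| <= L * `|x - y|) ->
  (forall x, 0 <= a x) ->
  (exists M : R, forall x, a x <= M) ->
  (forall n : nat, (n.+2 <= (k./2).*2)%N ->
     forall x, derivable (derive1n n a) x 1) ->
  (* parameters of the nonlocal term *)
  0 <= b -> 0 < lam < 1 -> 0 < c ->
  (* convective numerical flux *)
  (exists L : R, forall x y x' y',
      `|fhat x y - fhat x' y'| <= L * (`|x - x'| + `|y - y'|)) ->
  (forall u, fhat u u = f u) ->
  (forall x x' y, x <= x' -> fhat x y <= fhat x' y) ->
  (forall x y y', y <= y' -> fhat x y' <= fhat x y) ->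
  (* admissible diffusive flux *)
  0 < gamma < 1 -> 0 < alpha ->
  admissible a beta k dx gamma alpha ->
  (* initial datum in L^2 *)
  measurable_fun setT u0 ->
  (@lebesgue_measure R).-integrable setT (fun x => ((u0 x) ^+ 2)%:E) ->
  (* uhat in C^1([0,T]; V^k cap L^2) with derivative uhat_t *)
  (forall t, inVk k (P^~ t)) ->
  (forall t, inVk k (Q^~ t)) ->
  (forall t, t \in `[0, T] -> (L2sq (pw dx (P^~ t)) < +oo)%E) ->
  (forall t, t \in `[0, T] -> (L2sq (pw dx (Q^~ t)) < +oo)%E) ->
  (forall t, t \in `[0, T] -> forall e : R, 0 < e ->
     exists2 d : R, 0 < d & forall h : R, h != 0 -> `|h| < d ->
       t + h \in `[0, T] ->
       (L2sq (fun x => (pw dx (P^~ (t + h)) x - pw dx (P^~ t) x) / h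
                       - pw dx (Q^~ t) x)%R <= e%:E)%E) ->
  (forall t, t \in `[0, T] -> forall e : R, 0 < e ->
     exists2 d : R, 0 < d & forall s : R, s \in `[0, T] -> `|s - t| < d ->
       (L2sq (fun x => pw dx (Q^~ s) x - pw dx (Q^~ t) x)%R <= e%:E)%E) ->
  (* initial condition (L^2 projection) *)
  (forall (i : int) (q : {poly R}), (size q <= k.+1)%N ->
     \int[@lebesgue_measure R]_(x in cell dx i) ((P i 0).[x] * q.[x])
     = \int[@lebesgue_measure R]_(x in cell dx i) (u0 x * q.[x])) ->
  (* the DDG scheme *)
  (forall t, t \in `]0, T[ -> forall (i : int) (q : {poly R}),
     (size q <= k.+1)%N ->
     \int[@lebesgue_measure R]_(x in cell dx i) ((Q i t).[x] * q.[x])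
     - \int[@lebesgue_measure R]_(x in cell dx i) (f (P i t).[x] * (q^`()).[x])
     + fhat (trm dx (P^~ t) (i + 1)) (trp dx (P^~ t) (i + 1)) * q.[node dx (i + 1)]
     - fhat (trm dx (P^~ t) i) (trp dx (P^~ t) i) * q.[node dx i]
     + \int[@lebesgue_measure R]_(x in cell dx i)
         (a (P i t).[x] * ((P i t)^`()).[x] * (q^`()).[x])
     - hflux a beta k dx (P^~ t) (i + 1) * q.[node dx (i + 1)]
     + hflux a beta k dx (P^~ t) i * q.[node dx i]
     = b * fracform c lam (cellfun dx i q) (pw dx (P^~ t))) ->
  (* the sums over i converge absolutely for a.e. t and are integrable in t *)
  {ae @lebesgue_measure R, forall t, t \in `]0, T[ ->
     zsummable (term_h a beta k dx (P^~ t))} ->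
  {ae @lebesgue_measure R, forall t, t \in `]0, T[ ->
     zsummable (term_A a dx (P^~ t))} ->
  {ae @lebesgue_measure R, forall t, t \in `]0, T[ ->
     zsummable (term_a a dx (P^~ t))} ->
  (@lebesgue_measure R).-integrable `[0, T]
     (fun t => (zsum (term_h a beta k dx (P^~ t)))%:E) ->
  (@lebesgue_measure R).-integrable `[0, T]
     (fun t => (zsum (term_A a dx (P^~ t)))%:E) ->
  (@lebesgue_measure R).-integrable `[0, T]
     (fun t => (zsum (term_a a dx (P^~ t)))%:E) ->
  (L2sq (pw dx (P^~ T)) + (2 * GammaT a dx gamma alpha T P)%R%:E
   + (b * c)%R%:E * \int[@lebesgue_measure R]_(t in `[0%R, T])
                     Hsemi2 lam (pw dx (P^~ t))
   <= L2sq u0)%E.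

Proof.
move=> T0 dx0 [L fL] f0 _ _ _ _ b0 lam01 c0 _ fhatE fhat1 fhat2 gam01 al0 adm
  mu0 iu0 VP VQ sP sQ dPQ cQ proj scheme sumh sumA suma ih iA ia.
set mu := @lebesgue_measure R; set mu2 := (mu \x mu)%E.
pose u t := pw dx (P^~ t); pose v t := pw dx (Q^~ t).
have su t : t \in `[0, T] -> sqint mu (u t) by move=> tT; apply: L2pwP => //; exact: sP.
have sv t : t \in `[0, T] -> sqint mu (v t) by move=> tT; apply: L2pwP => //; exact: sQ.
have duv t : t \in `[0, T] -> forall e : R, 0 < e ->
  exists2 d : R, 0 < d & forall h : R, h != 0 -> `|h| < d -> t + h \in `[0, T] ->
    ip mu (fun x => (u (t + h) x - u t x) / h - v t x)
         (fun x => (u (t + h) x - u t x) / h - v t x) <= e.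
  move=> tT e e0; have [d d0 H] := dPQ t tT e e0; exists d => // h h0 hd hT.
  rewrite -lee_fin -ipE; first exact: H.
  apply: sqintB (sv t tT).
  have := sqintZ h^-1 (sqintB (su _ hT) (su t tT)).
  by congr sqint; apply/funext => x; rewrite mulrC.
have cv : L2cont T mu v.
  move=> t tT e e0; have [d d0 H] := cQ t tT e e0; exists d => // s sT sd.
  by rewrite -lee_fin -ipE; [exact: H|exact: sqintB (sv s sT) (sv t tT)].
have cu := differentiable_L2cont su sv duv.
pose gag t := gagliardo lam (u t).
have sgag t : t \in `[0, T] -> sqint mu2 (gag t).
  by move=> tT; apply: (sqint_gagliardo lam01 dx0 (VP t)); exact: su.
have [K K0 HK] := ip_gagliardo_le k lam01 dx0.
(* The difference of two time slices is again in [V^k], so the seminorm bound carries L^2 continuity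
   over to the weighted differences. *)
have cgag : L2cont T mu2 gag.
  move=> t tT e e0; have eK : 0 < e / (K + 1) by rewrite divr_gt0// ltr_wpDl.
  apply: near_on_mono (cu t tT _ eK) => s sT hs.
  have uB : (fun x => u s x - u t x) = pw dx (fun i => P i s - P i t).
    by apply/funext => x; rewrite /u /pw hornerD hornerN.
  have VB : inVk k (fun i => P i s - P i t).
    move=> i; rewrite (leq_trans (size_polyD _ _))// size_polyN geq_max.
    by rewrite (VP s i) (VP t i).
  have sB : L2pw dx (fun i => P i s - P i t).
    by rewrite /L2pw -uB; exact: sqintB (su s sT) (su t tT).
  have -> : (fun p => gag s p - gag t p) = gagliardo lam (fun x => u s x - u t x).
    by apply/funext => p; rewrite gagliardoB.
  rewrite uB; apply: (le_trans (HK _ VB sB)); rewrite -uB.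
  apply: (le_trans (ler_wpM2l K0 hs)).
  rewrite mulrA ler_pdivrMr ?ltr_wpDl// mulrC ler_wpM2l ?(ltW e0)//.
  by rewrite lerDl.
pose H t := ip mu2 (gag t) (gag t); pose G t := 2 * ip mu (v t) (u t).
pose Sa t := zsum (term_a a dx (P^~ t)); pose SA t := zsum (term_A a dx (P^~ t)).
have cH : cont_on T H by exact: ip_cont_on.
have cG : cont_on T G.
  move=> t tT e e0; have e2 : 0 < e / 2 by rewrite divr_gt0.
  apply: near_on_mono (ip_cont_on sv su cv cu tT e2) => s sT h.
  by rewrite -mulrBr normrM ger0_norm// mulrC -ler_pdivlMr.
have iH := cont_on_integrable cH; have iG := cont_on_integrable cG.
(* Off the three null sets, admissibility replaces the sum of [term_h] by [alpha SA - gamma Sa].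
   Doubling makes the first term the time derivative of the squared norm and turns the factor
   [c / 2] of the form into [c]. *)
have ae_le : {ae mu, forall t, t \in `]0, T[ ->
    G t + (2 * (1 - gamma)) * Sa t + (2 * alpha) * SA t + (b * c) * H t <= 0}.
  have [N1 [mN1 N10 sub1]] := sumh; have [N2 [mN2 N20 sub2]] := sumA.
  have [N3 [mN3 N30 sub3]] := suma.
  have nN : mu.-negligible (N1 `|` N2 `|` N3).
    by apply: negligibleU; [apply: negligibleU|]; exact/negligibleP.
  apply: negligibleS nN => t /= nt; apply: contrapT => /not_orP[/not_orP[t1 t2] t3].
  apply: nt => t0T.
  have h1 : zsummable (term_h a beta k dx (P^~ t)).
    by apply: contrapT => h; apply: t1; apply: sub1 => /= /(_ t0T).
  have h2 : zsummable (term_A a dx (P^~ t)).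
    by apply: contrapT => h; apply: t2; apply: sub2 => /= /(_ t0T).
  have h3 : zsummable (term_a a dx (P^~ t)).
    by apply: contrapT => h; apply: t3; apply: sub3 => /= /(_ t0T).
  have tT : t \in `[0, T] by exact: subset_itv_oo_cc t0T.
  have ad := adm _ (VP t) h1 h2 h3.
  have en : ip mu (v t) (u t) + Sa t + zsum (term_h a beta k dx (P^~ t))
      - b * (- (c / 2) * H t) <= 0.
    rewrite /H -(fracformE lam01).
    exact: (@energy_inequality R lam dx b c k lam01 dx0 f a fhat L
      (hflux a beta k dx (P^~ t)) fL f0 fhatE fhat1 fhat2 (P^~ t) (Q^~ t) (VP t)
      (su t tT) (sv t tT) (scheme t t0T) h3 h1).
  rewrite /G; move: ad en; rewrite -/(SA t) -/(Sa t).
  move: (ip mu (v t) (u t)) (Sa t) (SA t) (H t) (zsum _) => g1 g2 g3 g4 g5 ad en.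
  have -> : b * c * g4 = 2 * (- (b * (- (c / 2) * g4))) by field.
  lra.
have iSa : mu.-integrable `[0, T] (EFin \o Sa) by exact: ia.
have iSA : mu.-integrable `[0, T] (EFin \o SA) by exact: iA.
have mI : measurable (`[0, T]%classic : set (measurableTypeR R)) by exact: measurable_itv.
have i1 : mu.-integrable `[0, T] (EFin \o (fun t => (2 * (1 - gamma)) * Sa t)).
  exact: (integrableZl mI (2 * (1 - gamma)) iSa).
have i2 : mu.-integrable `[0, T] (EFin \o (fun t => (2 * alpha) * SA t)).
  exact: (integrableZl mI (2 * alpha) iSA).
have i3 : mu.-integrable `[0, T] (EFin \o (fun t => (b * c) * H t)).
  exact: (integrableZl mI (b * c) iH).
have i4 : mu.-integrable `[0, T] (EFin \o (fun t => G t + (2 * (1 - gamma)) * Sa t)).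
  exact: (integrableD mI iG i1).
have i5 : mu.-integrable `[0, T]
    (EFin \o (fun t => G t + (2 * (1 - gamma)) * Sa t + (2 * alpha) * SA t)).
  exact: (integrableD mI i4 i2).
have i6 : mu.-integrable `[0, T] (EFin \o (fun t =>
    G t + (2 * (1 - gamma)) * Sa t + (2 * alpha) * SA t + (b * c) * H t)).
  exact: (integrableD mI i5 i3).
have := ae_le0_Rintegral i6 ae_le.
rewrite (RintegralD mI i5 i3) (RintegralD mI i4 i2) (RintegralD mI iG i1).
rewrite (RintegralZl _ mI iSa) (RintegralZl _ mI iSA) (RintegralZl _ mI iH).
have -> : \int[mu]_(t in `[0, T]) G t = ip mu (u T) (u T) - ip mu (u 0) (u 0).
  by rewrite /Rintegral (integral_ip_derivative su sv duv T0 cv).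
have T0I : 0 \in `[0, T] by rewrite in_itv/= lexx ltW.
have TTI : T \in `[0, T] by rewrite in_itv/= lexx ltW.
have g0 : (L2sq (u 0%R) <= L2sq u0)%E.
  by apply: L2_projection_le => // i; apply: proj; exact: VP.
move=> main; apply: le_trans g0.
(* The seminorm is finite and continuous in time, so the extended integral is a real number and the
   conclusion becomes an inequality between reals. *)
have -> : (\int[mu]_(t in `[0%R, T]) Hsemi2 lam (pw dx (P^~ t))
         = (\int[mu]_(t in `[0, T]) H t)%:E)%E.
  rewrite /Rintegral fineK; last exact: integrable_fin_num.
  apply: eq_integral => t; rewrite inE/= => tT.
  by rewrite (Hsemi2E lam01) ?ipE//; [exact: sgag|exact: measurable_pw].
rewrite !L2sqE; [|exact: su|exact: su].
rewrite -EFinM -!EFinD lee_fin /GammaT; move: main.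
rewrite -/(u T) -/(u 0) -/mu.
move: (ip mu (u T) (u T)) (ip mu (u 0) (u 0)) => gT g0'.
move: (\int[mu]_(t in `[0, T]) Sa t) (\int[mu]_(t in `[0, T]) SA t)
  (\int[mu]_(t in `[0, T]) H t) => x y z; lra.
Qed.
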